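(* Let $\mathcal A$ be an algebra satisfying the standing assumptions, and let $G=G_1\sqcup G_2$ be a graph, where $G_2$ is the union of the connected components of $G$ that are trees and $G_1$ is the union of the remaining components. Let $v_i$ be the number of vertices of $G_i$ and $\mu_i$ the number of connected components of $G_i$ ($i=1,2$). Then: (a) if $H^i_{\mathcal A}(G)\neq 0$ then $0\le i\le v_1-2\mu_1$; (b) if $\mathrm{Tor}(H^i_{\mathcal A}(G))\ne 0$ then $1\le i\le v_1-2\mu_1$.
   Context: Graphs are finite and undirected, and may have loops and multiple edges. Standing assumptions on $\mathcal A$: $\mathcal A=\bigoplus_{i\ge 0}A_i$ is a commutative graded $\mathbb Z$-algebra with identity such that each $A_i$ is a free $\mathbb Z$-module of finite rank. Graph cohomology over $\mathcal A$: let $G$ be a graph with ordered edges $e_1,\dots,e_n$. For $s\subseteq E(G)$ let $[G:s]$ be the graph with vertex set $V(G)$ and edge set $s$, and let $C^{s}(G)=\mathcal A^{\otimes k}$ (tensor over $\mathbb Z$, one factor per connected component of $[G:s]$, $k$ being the number of components), with the induced grading. Put $C^i(G)=\bigoplus_{|s|=i}C^s(G)$. For $e\notin s$ the per-edge map $C^{s}(G)\to C^{s\cup\{e\}}(G)$ is the identity if $e$ joins a component of $[G:s]$ to itself; if $e$ joins two different components it multiplies the two corresponding tensor factors via $\mathcal A\otimes\mathcal A\to\mathcal A$ and is the identity on the other factors. The differential $d^i:C^i(G)\to C^{i+1}(G)$ is the sum of the per-edge maps over all $|s|=i$ and $e=e_r\notin s$, with sign $(-1)^{\#\{t<r:\ e_t\in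 s\}}$. It preserves degree; $H^{i,j}_{\mathcal A}(G)$ is the degree $j$ part of the $i$-th cohomology $H^i_{\mathcal A}(G)$. $\mathrm{Tor}(M)$ denotes the torsion subgroup of an abelian group $M$. *)

(* Defs.v *)
(* MathComp world, with classical logic from MathComp-Analysis. *)
From HB Require Import structures.
From mathcomp Require Import all_boot all_order all_algebra.
From mathcomp Require Import boolp classical_sets.
From mathcomp.multinomials Require Import freeg.

Set Implicit Arguments.
Unset Strict Implicit.
Unset Printing Implicit Defensive.

Import Order.TTheory GRing.Theory Num.Theory.
Import Quotient.Exports.

Local Open Scope ring_scope.
Local Open Scope quotient_scope.

(* A = (+)_i A_i as a graded ring, each A_i being a free Z-module of finite    *)
(* rank.  A is a comPzRingType so that the zero algebra is not excluded.       *)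
Record graded_free_algebra (A : comPzRingType) (A_ : nat -> set A) : Prop := {
  grade0 : forall i, A_ i 0;
  gradeB : forall i a b, A_ i a -> A_ i b -> A_ i (a - b);
  grade_one : A_ 0%N 1;
  gradeM : forall i j a b, A_ i a -> A_ j b -> A_ (i + j)%N (a * b);
  grade_sum : forall a, exists n (c : nat -> A),
    (forall i, A_ i (c i)) /\ a = \sum_(i < n) c i;
  grade_direct : forall n (c : nat -> A), (forall i, A_ i (c i)) ->
    \sum_(i < n) c i = 0 -> forall i, (i < n)%N -> c i = 0;
  grade_free : forall i, exists r (b : 'I_r -> A),
    (forall k, A_ i (b k)) /\
    forall a, A_ i a -> exists! m : {ffun 'I_r -> int}, a = \sum_k b k *~ m k
}.

Section Tensor.
Variable A : comPzRingType.

(* The tensor power of A over Z with one factor for each i : I, as the free    *)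
(* abelian group on I -> A modulo additivity in each argument (over Z this     *)
(* entails homogeneity).                                                       *)
Section TensorPower.
Variable I : finType.

Definition upd (a : {ffun I -> A}) (i : I) (x : A) : {ffun I -> A} :=
  [ffun j => if j == i then x else a j].

Definition gen (a : {ffun I -> A}) : {freeg {ffun I -> A}} :=
  [freeg [:: (1, a)]].

Inductive tensor_rel : {freeg {ffun I -> A}} -> Prop :=
| tensor_rel0 : tensor_rel 0
| tensor_relB u v : tensor_rel u -> tensor_rel v -> tensor_rel (u - v)
| tensor_rel_add a i x y :
    tensor_rel (gen (upd a i (x + y)) - gen (upd a i x) - gen (upd a i y)).

Definition tensor_null : {pred {freeg {ffun I -> A}}} :=
  fun u => `[< tensor_rel u >].

Fact tensor_null_closed : zmod_closed tensor_null.
Proof.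
split=> [|u v /asboolP ru /asboolP rv]; apply/asboolP.
  exact: tensor_rel0.
exact: tensor_relB.
Qed.

HB.instance Definition _ :=
  GRing.isZmodClosed.Build {freeg {ffun I -> A}} tensor_null tensor_null_closed.

Definition tensor : zmodType := Quotient.quot tensor_null.

Definition tensor_pi (u : {freeg {ffun I -> A}}) : tensor :=
  \pi_(Quotient.quot tensor_null) u.

Definition tensor_repr (t : tensor) : {freeg {ffun I -> A}} :=
  repr (t : Quotient.quot tensor_null).

Definition pure (a : {ffun I -> A}) : tensor := tensor_pi (gen a).

Lemma tensor_pi_is_zmod_morphism : zmod_morphism tensor_pi.
Proof. exact: (raddfB (\pi_(Quotient.quot tensor_null))). Qed.

HB.instance Definition _ :=
  GRing.isZmodMorphism.Build _ tensor tensor_pi tensor_pi_is_zmod_morphism.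

Lemma tensor_reprK : cancel tensor_repr tensor_pi.
Proof. exact: reprK. Qed.

Lemma tensor_pi_eq u v : tensor_pi u = tensor_pi v <-> tensor_rel (u - v).
Proof.
split=> [uv|ruv]; last first.
  by apply/eqP; rewrite /tensor_pi -Quotient.idealrBE; apply/asboolP.
by apply/asboolP; move/eqP: uv; rewrite /tensor_pi -Quotient.idealrBE.
Qed.

End TensorPower.

(* A map f : I -> J of index sets induces                                      *)
(*   (x)_i a_i |-> (x)_j (\prod_(f i = j) a_i).                                *)
Section TensorMap.
Variables (I J : finType) (f : I -> J).

Definition merge (a : {ffun I -> A}) : {ffun J -> A} :=
  [ffun j => \prod_(i | f i == j) a i].

Definition tensor_map (t : tensor I) : tensor J :=
  tensor_pi (fglift (fun a => gen (merge a)) (tensor_repr t)).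

Let lift := fglift (fun a => gen (merge a)).

Let liftB : zmod_morphism lift.
Proof. exact: lift_is_additive. Qed.

Let lift_gen a : lift (gen a) = gen (merge a).
Proof. by rewrite /lift /gen liftU scale1r. Qed.

Let merge_upd a i x :
  merge (upd a i x) =
  upd (merge a) (f i) (x * \prod_(k | (f k == f i) && (k != i)) a k).
Proof.
apply/ffunP=> j; rewrite !ffunE; case: eqP => [->|/eqP ne].
  rewrite (bigD1 i) //= ffunE eqxx; congr (_ * _).
  by apply: eq_bigr => k /andP[_ /negbTE ki]; rewrite ffunE ki.
apply: eq_bigr => k /eqP fk; rewrite ffunE; case: eqP => // ki.
by case/eqP: ne; rewrite -fk ki.
Qed.

Let lift_rel u : tensor_rel u -> tensor_rel (lift u).
Proof.
elim=> [|{}u v _ ru _ rv|a i x y].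
- by rewrite -(subrr 0) liftB subrr; exact: tensor_rel0.
- by rewrite liftB; exact: tensor_relB.
- by rewrite !liftB !lift_gen !merge_upd mulrDl; exact: tensor_rel_add.
Qed.

Lemma tensor_map_pi u : tensor_map (tensor_pi u) = tensor_pi (lift u).
Proof.
by apply/tensor_pi_eq; rewrite -liftB; apply/lift_rel/tensor_pi_eq/tensor_reprK.
Qed.

Lemma tensor_map_pure a : tensor_map (pure a) = pure (merge a).
Proof. by rewrite tensor_map_pi lift_gen. Qed.

Lemma tensor_map_is_zmod_morphism : zmod_morphism tensor_map.
Proof.
move=> s t; rewrite -[s]tensor_reprK -[t]tensor_reprK -raddfB !tensor_map_pi.
by rewrite liftB raddfB.
Qed.

HB.instance Definition _ := GRing.isZmodMorphism.Build
  (tensor I) (tensor J) tensor_map tensor_map_is_zmod_morphism.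

End TensorMap.
End Tensor.

(* Finite direct sums of a family of abelian groups.                           *)
Definition dsum (I : finType) (M : I -> zmodType) := {dffun forall i, M i}.

Section DirectSum.
Variables (I : finType) (M : I -> zmodType).

HB.instance Definition _ := Choice.copy (dsum M) {dffun forall i, M i : choiceType}.

Definition dsum_mk (u : forall i, M i) : dsum M := finfun u.
Definition dsum_zero : dsum M := dsum_mk (fun i => 0).
Definition dsum_opp (u : dsum M) : dsum M := dsum_mk (fun i => - u i).
Definition dsum_add (u v : dsum M) : dsum M := dsum_mk (fun i => u i + v i).

Fact dsum_addA : associative dsum_add.
Proof. by move=> u v w; apply/ffunP=> i; rewrite !ffunE addrA. Qed.
Fact dsum_addC : commutative dsum_add.
Proof. by move=> u v; apply/ffunP=> i; rewrite !ffunE addrC. Qed.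
Fact dsum_add0 : left_id dsum_zero dsum_add.
Proof. by move=> u; apply/ffunP=> i; rewrite !ffunE add0r. Qed.
Fact dsum_addN : left_inverse dsum_zero dsum_opp dsum_add.
Proof. by move=> u; apply/ffunP=> i; rewrite !ffunE addNr. Qed.

HB.instance Definition _ :=
  GRing.isZmodule.Build (dsum M) dsum_addA dsum_addC dsum_add0 dsum_addN.

Lemma dsum0E i : (0 : dsum M) i = 0. Proof. by rewrite ffunE. Qed.
Lemma dsumBE (u v : dsum M) i : (u - v) i = u i - v i.
Proof. by rewrite !ffunE. Qed.

End DirectSum.

(* Finite undirected multigraphs with totally ordered edges; an edge with ends *)
(* (x, y) is the same as one with ends (y, x), and it is a loop when x = y.    *)
Record graph := Graph {
  vertex :> finType;
  num_edges : nat;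
  ends : 'I_num_edges -> vertex * vertex
}.

Definition edge (G : graph) := 'I_(num_edges G).

Definition joins (G : graph) (e : edge G) (x y : G) : bool :=
  (ends e == (x, y)) || (ends e == (y, x)).

(* Adjacency in the spanning subgraph [G : s].                                 *)
Definition adj (G : graph) (s : {set edge G}) (x y : G) : bool :=
  [exists e in s, joins e x y].

Section Components.
Variables (G : graph) (s : {set edge G}).

Lemma adj_connect_sym : connect_sym (adj s).
Proof.
apply: sym_connect_sym => x y; rewrite /adj.
by apply: eq_existsb => e; rewrite /joins orbC.
Qed.

(* A component of [G : s] is encoded by its canonical representative.          *)
Definition component := {x : G | x \in fingraph.roots (adj s)}.

Definition component_of (x : G) : component :=
  Sub (fingraph.root (adj s) x) (roots_root adj_connect_sym x).

End Components.

Section Cohomology.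
Variables (A : comPzRingType) (G : graph).

Definition state_group (s : {set edge G}) : zmodType := tensor A (component s).

(* Used for t = e |: s only: the tensor factors of components of [G : s] lying *)
(* in the same component of [G : t] are multiplied, cf. edge_map_pure.         *)
Definition edge_map (s t : {set edge G}) : state_group s -> state_group t :=
  tensor_map (fun K : component s => component_of t (val K)).

HB.instance Definition _ s t := GRing.Additive.on (@edge_map s t).

Lemma connect_add_edge (s : {set edge G}) e x y : joins e x y ->
  forall u v, connect (adj (e |: s)) u v =
    [|| connect (adj s) u v,
        connect (adj s) u x && connect (adj s) y v |
        connect (adj s) u y && connect (adj s) x v].
Proof.
move=> exy u v; have sub : subrel (connect (adj s)) (connect (adj (e |: s))).
  apply: connect_sub => a b /existsP[r /andP[rs rab]]; apply: connect1.
  by apply/existsP; exists r; rewrite in_setU1 rs orbT.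
have xy : connect (adj (e |: s)) x y.
  by apply: connect1; apply/existsP; exists e; rewrite setU11.
have yx : connect (adj (e |: s)) y x by rewrite adj_connect_sym.
apply/idP/idP; last first.
  case/or3P=> [/sub //|/andP[/sub a /sub b]|/andP[/sub a /sub b]].
    exact: connect_trans a (connect_trans xy b).
  exact: connect_trans a (connect_trans yx b).
case/connectP=> p; elim: p u => [|w p IHp] u /=; first by move=> _ ->; rewrite connect0.
case/andP=> uw /IHp {}IHp /IHp {IHp} wv.
case/existsP: uw => r /andP[]; rewrite in_setU1 => /predU1P[->|rs] jr; last first.
  have uw : connect (adj s) u w by apply: connect1; apply/existsP; exists r; rewrite rs.
  have C a := connect_trans uw : connect (adj s) w a -> connect (adj s) u a.
  by case/or3P: wv => [/C ->|/andP[/C -> ->]|/andP[/C -> ->]]; rewrite ?orbT.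
have : (u == x) && (w == y) || (u == y) && (w == x).
  move: exy jr; rewrite /joins; case: (ends e) => a b; rewrite -!pair_eqE /=.
  by do 2!case/orP=> /andP[/eqP <- /eqP <-]; rewrite !eqxx ?orbT.
case/orP=> /andP[/eqP -> /eqP ew]; rewrite {}ew in wv *.
all: by case/or3P: wv => [->|/andP[? ->]|/andP[? ->]]; rewrite !connect0 ?orbT.
Qed.

(* If e joins a component to itself, edge_map is the identity; if e joins two  *)
(* different components, it multiplies their factors and fixes the others.     *)
Lemma edge_map_pure (s : {set edge G}) e x y (a : {ffun component s -> A}) :
  joins e x y ->
  edge_map (e |: s) (pure a) = pure [ffun L : component (e |: s) =>
    if ~~ connect (adj s) x y && connect (adj (e |: s)) (val L) x
    then a (component_of s x) * a (component_of s y)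
    else a (component_of s (val L))].
Proof.
move=> exy; rewrite /edge_map tensor_map_pure; congr pure; apply/ffunP=> L.
rewrite !ffunE.
have ofE (K : component s) : component_of s (val K) = K.
  by apply: val_inj; apply/eqP; apply: (valP K).
have of_eq z (K : component s) : (component_of s z == K) = connect (adj s) z (val K).
  by rewrite -[K in LHS]ofE -val_eqE /= root_connect //; exact: adj_connect_sym.
have toL (K : component s) :
    (component_of (e |: s) (val K) == L) = connect (adj (e |: s)) (val L) (val K).
  rewrite adj_connect_sym -val_eqE /= -root_connect; last exact: adj_connect_sym.
  by rewrite (eqP (valP L : fingraph.root _ _ == _)).
under eq_bigl do rewrite toL.
case: ifP => [/andP[nxy Lx]|].
  have tE K : connect (adj (e |: s)) (val L) (val K) =
      (component_of s x == K) || (component_of s y == K).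
    rewrite (same_connect (@adj_connect_sym _ _) Lx) (connect_add_edge s exy).
    by rewrite connect0 (negbTE nxy) /= orbF !of_eq.
  under eq_bigl do rewrite tE.
  have ne : component_of s y != component_of s x.
    by rewrite eq_sym -val_eqE /= root_connect ?nxy //;
       exact: adj_connect_sym.
  rewrite (bigD1 (component_of s x)) ?eqxx //= (bigD1 (component_of s y)) /=.
    rewrite big1 ?mulr1 // => K /andP[/andP[/orP[]/eqP<-]]; by rewrite eqxx.
  by rewrite eqxx orbT ne.
move=> /negbT; rewrite negb_and negbK => h.
rewrite (big_pred1 (component_of s (val L))) // => K.
rewrite [RHS]eq_sym of_eq (connect_add_edge s exy).
case/orP: h => [xy|].
  apply/or3P/idP => [[//|/andP[Lx yK]|/andP[Ly xK]]|->]; last by constructor.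
    exact: connect_trans Lx (connect_trans xy yK).
  by apply: connect_trans Ly (connect_trans _ xK); rewrite adj_connect_sym.
rewrite (connect_add_edge s exy) connect0 !andbT.
by case/norP => /negbTE -> /norP[_ /negbTE ->]; rewrite !orbF.
Qed.

Definition cochain := dsum state_group.
HB.instance Definition _ := GRing.Zmodule.on cochain.

Definition edge_sign (s : {set edge G}) (e : edge G) : int :=
  (-1) ^+ #|[set r in s | (r < e)%N]|.

Definition differential (u : cochain) : cochain :=
  dsum_mk (fun t : {set edge G} =>
    \sum_(s : {set edge G}) \sum_(e | (e \notin s) && (e |: s == t))
      edge_map t (u s) *~ edge_sign s e).

(* C^i(G) as a subgroup of the total complex; it is 0 for i < 0.               *)
Definition in_degree (i : int) (u : cochain) : bool :=
  [forall s : {set edge G}, (#|s|%:Z != i) ==> (u s == 0)].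

Definition cocycles (i : int) : {pred cochain} :=
  fun u => in_degree i u && (differential u == 0).

Fact differential_is_zmod_morphism : zmod_morphism differential.
Proof.
move=> u v; apply/ffunP=> t; rewrite dsumBE !ffunE -sumrB; apply: eq_bigr => s _.
by rewrite -sumrB; apply: eq_bigr => e _; rewrite dsumBE raddfB mulrzBl.
Qed.

HB.instance Definition _ := GRing.isZmodMorphism.Build
  cochain cochain differential differential_is_zmod_morphism.

Fact in_degree0 i : in_degree i 0.
Proof. by apply/forallP=> s; rewrite dsum0E eqxx implybT. Qed.

Fact in_degreeB i u v : in_degree i u -> in_degree i v -> in_degree i (u - v).
Proof.
move=> /forallP du /forallP dv; apply/forallP=> s; apply/implyP=> si.
by rewrite dsumBE (eqP (implyP (du s) si)) (eqP (implyP (dv s) si)) subrr.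
Qed.

Fact cocycles_closed i : zmod_closed (cocycles i).
Proof.
split=> [|u v /andP[du /eqP zu] /andP[dv /eqP zv]]; apply/andP; split.
- exact: in_degree0.
- by rewrite raddf0.
- exact: in_degreeB.
- by rewrite raddfB /= zu zv subrr.
Qed.

HB.instance Definition _ i :=
  GRing.isZmodClosed.Build cochain (cocycles i) (cocycles_closed i).

Record cocycle (i : int) :=
  Cocycle { cocycle_val :> cochain; cocycleP : cocycle_val \in cocycles i }.

HB.instance Definition _ i := [isSub for @cocycle_val i].
HB.instance Definition _ i := [Choice of cocycle i by <:].
HB.instance Definition _ i := [SubChoice_isSubZmodule of cocycle i by <:].

Definition coboundaries (i : int) : {pred cocycle i} :=
  fun u => `[< exists2 w, in_degree (i - 1) w & differential w = u >].

Fact coboundaries_closed i : zmod_closed (@coboundaries i).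
Proof.
split=> [|u v /asboolP[w dw wu] /asboolP[w' dw' wv]]; apply/asboolP.
  by exists 0; [exact: in_degree0 | rewrite raddf0].
exists (w - w'); first exact: in_degreeB.
by rewrite raddfB /= wu wv.
Qed.

HB.instance Definition _ i :=
  GRing.isZmodClosed.Build (cocycle i) (@coboundaries i) (@coboundaries_closed i).

Definition cohomology (i : int) : zmodType := Quotient.quot (@coboundaries i).

End Cohomology.

Definition torsion (M : zmodType) : set M :=
  fun m => exists n, (0 < n)%N /\ m *+ n = 0.
Arguments torsion : clear implicits.

Section Trees.
Variable G : graph.

(* A closed walk x_0 e_0 x_1 e_1 ... x_k e_k x_0 with distinct vertices and    *)
(* distinct edges: a loop is a cycle (k = 0), and so are two parallel edges    *)
(* (k = 1).                                                                    *)
Definition is_cycle (c : seq (G * edge G)) : bool :=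
  [&& c != [::], uniq (unzip1 c), uniq (unzip2 c)
    & path.cycle (fun p q => joins p.2 p.1 q.1) c].

Definition in_tree_component (x : G) : Prop :=
  forall c, is_cycle c ->
    forall y, y \in unzip1 c -> ~~ connect (adj [set: edge G]) x y.

Definition tree_part : {set G} := [set x | `[< in_tree_component x >]].
Definition nontree_part : {set G} := ~: tree_part.

(* Meant for unions U of components of G.                                      *)
Definition num_components (U : {set G}) : nat := n_comp (adj [set: edge G]) U.

End Trees.

(* Main.v *)
(* Idea.  Contracting the edges of s0 and deleting those outside S turns G into *)

(* The statement proved by induction concerns a pair [s0 \subset S], read as the graph [[G : S]]
   with [s0] contracted. Let [U] be the union of the components that still contain a cycle, [v] the
   number of contracted vertices in [U] and [mu] the number of components of [U]. Then cohomology
   vanishes above degree [v - 2 mu], that is, above [#|s0| + v - 2 mu] in the grading of the full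
   complex ([exact_above]).

   For a non-bridge [e] outside [s0] that is not a loop after contraction, [exact_delete] reduces
   the claim to deletion and contraction. Contraction raises [#|s0|] by one, lowers [v] by at least
   one, and leaves a cycle in the component of [e]. Deletion leaves [v] and [mu] alone if that
   component keeps a cycle. Otherwise the component leaves [U], which costs [mu] one and [v] at
   least two, because the ends of [e] are distinct contracted vertices. So the bound never grows.
   The induction ends at a loop ([exact_loop]) or at a forest ([exact_forest]).

   [nontree_partP] identifies [U] for the whole graph with the non-tree part. For torsion, only
   degree 0 remains to be excluded: there are no coboundaries in that degree, so [tensor_mulrn_eq0]
   applies. *)
(* the graph of the pair (s0, S), whose complex is a subquotient of the full   *)
(* complex of G, so deletion-contraction takes place inside a single complex.  *)
(* An edge e that is not a bridge leaves the components unchanged when         *)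
(* deleted and removes one vertex when contracted, so the vanishing bound      *)
(* follows by induction on the number of edges from two base cases: a loop     *)
(* makes the complex the cone of an isomorphism, and a forest is acyclic in    *)
(* positive degree, because inserting 1 at a leaf splits the map from the      *)
(* deletion of its edge onto the contraction.  Finally H^0 is a subgroup of a  *)
(* tensor power of the free Z-module A, hence torsion-free.                    *)
From HB Require Import structures.
Require Import Defs.
From mathcomp Require Import boolp classical_sets.
From mathcomp Require Import all_boot all_order all_algebra.
From mathcomp.multinomials Require Import freeg.
From mathcomp Require Import zify.
Import Order.TTheory GRing.Theory Num.Theory.
Local Open Scope ring_scope.

Set Implicit Arguments.
Unset Strict Implicit.
Unset Printing Implicit Defensive.

(** * Maps between tensor powers *)

Section TensorTheory.
Variable A : comPzRingType.

Lemma tensor_ind (I : finType) (P : tensor A I -> Prop) :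
  P 0 -> (forall u v, P u -> P v -> P (u - v)) -> (forall a, P (pure a)) ->
  forall t, P t.
Proof.
move=> P0 PB Pp t; rewrite -[t]tensor_reprK.
have PN u : P u -> P (- u) by move=> Pu; rewrite -sub0r; exact: PB.
have PD u v : P u -> P v -> P (u + v).
  by move=> Pu Pv; rewrite -[v]opprK; apply: PB => //; exact: PN.
have PM u n : P u -> P (u *+ n).
  by move=> Pu; elim: n => [|n IHn]; rewrite ?mulr0n ?mulrS //; exact: PD.
have PZ u (z : int) : P u -> P (u *~ z).
  by case: z => n Pu; [exact: PM | apply: PN; exact: PM].
move: (tensor_repr t); apply: freeg_ind_dom0 => [|k x D _ _ IHD].
  by rewrite raddf0.
rewrite raddfD; apply: PD => //.
have -> : << k *g x >> = gen x *~ k by rewrite /gen freegU_mulz intz.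
by rewrite raddfMz; exact: PZ (Pp _).
Qed.

Lemma tensor_ext (I : finType) (M : zmodType) (f g : {additive tensor A I -> M}) :
  (forall a, f (pure a) = g (pure a)) -> f =1 g.
Proof.
move=> fg; apply: tensor_ind => [|u v fgu fgv|//]; first by rewrite !raddf0.
by rewrite !raddfB fgu fgv.
Qed.

Lemma tensor_map_comp (I J K : finType) (f : I -> J) (g : J -> K) (t : tensor A I) :
  tensor_map g (tensor_map f t) = tensor_map (g \o f) t.
Proof.
apply: (tensor_ext (f := tensor_map g \o tensor_map f)) => a /=.
rewrite !tensor_map_pure; congr pure; apply/ffunP=> k; rewrite !ffunE.
under eq_bigr do rewrite ffunE.
rewrite (partition_big f (fun j => g j == k)) //=.
apply: eq_bigr => j /eqP gj; apply: eq_bigl => i.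
by case: eqP => [->|]; rewrite ?gj ?eqxx ?andbT ?andbF.
Qed.

Lemma eq_tensor_map (I J : finType) (f g : I -> J) (t : tensor A I) :
  f =1 g -> tensor_map f t = tensor_map g t.
Proof.
move=> fg; apply: (tensor_ext (f := tensor_map f) (g := tensor_map g)) => a /=.
rewrite !tensor_map_pure; congr pure.
by apply/ffunP=> j; rewrite !ffunE; apply: eq_bigl => i; rewrite fg.
Qed.

Lemma tensor_map_id (I : finType) (t : tensor A I) : tensor_map id t = t.
Proof.
apply: (tensor_ext (f := tensor_map id) (g := idfun)) => a /=.
rewrite tensor_map_pure; congr pure.
by apply/ffunP=> j; rewrite ffunE big_pred1_eq.
Qed.

End TensorTheory.

(** * The differential *)

Section GraphTheory.
Variable G : graph.
Implicit Types (s t S : {set edge G}) (x y z : G) (e f : edge G).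

Lemma connect_adj_sym s x y : connect (adj s) x y = connect (adj s) y x.
Proof. exact: adj_connect_sym. Qed.

Lemma connect_adj_subset s t x y :
  s \subset t -> connect (adj s) x y -> connect (adj t) x y.
Proof.
move=> st; apply: connect_sub => {}x {}y /existsP[r /andP[rs rxy]].
by apply: connect1; apply/existsP; exists r; rewrite (subsetP st).
Qed.

Lemma connect_joins s e x y : joins e x y -> e \in s -> connect (adj s) x y.
Proof. by move=> exy es; apply: connect1; apply/existsP; exists e; rewrite es. Qed.

Lemma joins_sym e x y : joins e x y = joins e y x.
Proof. by rewrite /joins orbC. Qed.

Lemma joins_ends e : joins e (ends e).1 (ends e).2.
Proof. by rewrite /joins -surjective_pairing eqxx. Qed.

Lemma joins_eq e x y a b :
  joins e x y -> joins e a b -> (a == x) && (b == y) || (a == y) && (b == x).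
Proof.
rewrite /joins; case: (ends e) => c d; rewrite -!pair_eqE /=.
by do 2!case/orP=> /andP[/eqP <- /eqP <-]; rewrite !eqxx ?orbT.
Qed.

Lemma component_of_eq s x y :
  (component_of s x == component_of s y) = connect (adj s) x y.
Proof. by rewrite -val_eqE /= root_connect //; exact: adj_connect_sym. Qed.

Lemma component_ofK s (K : component s) : component_of s (val K) = K.
Proof. by apply: val_inj; apply/eqP; apply: (valP K). Qed.

Lemma connect_component_of s x : connect (adj s) (val (component_of s x)) x.
Proof. by rewrite -component_of_eq component_ofK. Qed.

Definition incidence s t : int :=
  \sum_(e | (e \notin s) && (e |: s == t)) edge_sign s e.

Lemma incidence_neq0 s t :
  incidence s t != 0 -> exists2 e, e \notin s & t = e |: s.
Proof.
have [e /= /andP[es /eqP <-] _|no] := pickP (fun e => (e \notin s) && (e |: s == t)).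
  by exists e.
by rewrite /incidence big_pred0 // eqxx.
Qed.

Lemma incidence_setU1 s e : e \notin s -> incidence s (e |: s) = edge_sign s e.
Proof.
move=> es; rewrite /incidence (big_pred1 e) // => f /=.
apply/idP/eqP => [/andP[fs /eqP fe]|->]; last by rewrite es eqxx.
have : f \in e |: s by rewrite -fe setU11.
by rewrite in_setU1 (negbTE fs) orbF => /eqP.
Qed.

Lemma edge_sign_setU1 s e f : f \notin s ->
  edge_sign (f |: s) e = edge_sign s e * (-1) ^+ (f < e)%N.
Proof.
move=> fs; rewrite /edge_sign -exprD; congr (_ ^+ _).
have [fe|fe] := boolP (f < e)%N.
  rewrite (_ : [set r in f |: s | (r < e)%N] = f |: [set r in s | (r < e)%N]).
    by rewrite cardsU1 !inE (negbTE fs) addnC.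
  by apply/setP=> r; rewrite !inE; case: eqP => // ->; rewrite fe.
rewrite addn0; apply: eq_card => r; rewrite !inE.
by case: eqP => // ->; rewrite (negbTE fe) !andbF.
Qed.

Lemma edge_sign_anticomm s e f : e \notin s -> f \notin s -> e != f ->
  edge_sign s f * edge_sign (f |: s) e = - (edge_sign s e * edge_sign (e |: s) f).
Proof.
move=> es fs ef; rewrite !edge_sign_setU1 // !mulrA [in RHS](mulrC (edge_sign s e)).
rewrite -mulrN; congr (_ * _).
by move: ef; rewrite -val_eqE neq_ltn => /orP[] lt;
  rewrite lt ltnNge (ltnW lt) expr0 ?opprK.
Qed.

Lemma incidence_comp s t : \sum_s' incidence s s' * incidence s' t = 0.
Proof.
pose g f e := edge_sign s f * edge_sign (f |: s) e.
pose P f e := [&& f \notin s, e \notin f |: s & e |: (f |: s) == t].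
have PC f e : P f e = P e f.
  rewrite /P !in_setU1 !negb_or (eq_sym f) (setUCA [set f]).
  by case: (f \in s); case: (e \in s); rewrite /= ?andbF ?andbT.
(* Both sums run over ordered pairs of added edges. Swapping the order reverses the sign, so the
   double sum equals its own negative in the integers. *)
suff E : \sum_s' incidence s s' * incidence s' t = \sum_f \sum_(e | P f e) g f e.
  have : \sum_f \sum_(e | P f e) g f e = - (\sum_f \sum_(e | P f e) g f e).
    rewrite {1}(exchange_big_dep xpredT) //= -sumrN; apply: eq_bigr => f _.
    rewrite -sumrN (eq_bigl (P f)) => [|e]; last exact: PC.
    apply: eq_bigr => e; rewrite /P in_setU1 negb_or => /and3P[fs /andP[ef es] _].
    by rewrite /g edge_sign_anticomm // eq_sym.
  by rewrite E => /eqP; rewrite -addr_eq0 -mulr2n mulrn_eq0 => /eqP.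
under eq_bigr => s' _ do rewrite [incidence s s']/incidence mulr_suml.
rewrite (exchange_big_dep (fun f => f \notin s)) => [|s' f _ /andP[]] //=.
rewrite [RHS](bigID (fun f => f \notin s)) /= [X in _ = _ + X]big1 ?addr0; last first.
  by move=> f fs; apply: big_pred0 => e; rewrite /P (negbTE fs).
apply: eq_bigr => f fs; rewrite (big_pred1 (f |: s)) => [|s']; last first.
  by rewrite fs eq_sym.
rewrite mulr_sumr; apply: eq_bigl => e; by rewrite /P fs.
Qed.

End GraphTheory.

Section Differential.
Variables (A : comPzRingType) (G : graph).
Implicit Types (s t S : {set edge G}) (x y z : G) (e f : edge G) (u v w : cochain A G).

(** This makes the cube of edge maps commute: each edge map is induced by a map of components, and
    these maps compose. *)
Lemma edge_map_comp s s' t (a : state_group A s) :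
  s' \subset t -> edge_map t (edge_map s' a) = edge_map t a.
Proof.
move=> st; rewrite /edge_map tensor_map_comp; apply: eq_tensor_map => K /=.
by apply/eqP; rewrite component_of_eq; apply/(connect_adj_subset st)/connect_component_of.
Qed.

Lemma edge_mapMz s t (a : state_group A s) (m : int) :
  edge_map t (a *~ m) = edge_map t a *~ m.
Proof. exact: (raddfMz (edge_map t)). Qed.

Lemma differentialE u t :
  differential u t = \sum_s edge_map t (u s) *~ incidence s t.
Proof. by rewrite ffunE; apply: eq_bigr => s _; rewrite mulrz_sumr. Qed.

Lemma differentialK u : differential (differential u) = 0.
Proof.
apply/ffunP=> t; rewrite dsum0E differentialE.
under eq_bigr => s' _ do rewrite differentialE (raddf_sum (edge_map t)) mulrz_suml.
rewrite exchange_big big1 //= => s _.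
transitivity (edge_map t (u s) *~ \sum_s' incidence s s' * incidence s' t).
  rewrite mulrz_sumr; apply: eq_bigr => s' _.
  rewrite edge_mapMz -mulrzA.
  have [->|/incidence_neq0[e _ ->]] := eqVneq (incidence s' t) 0.
    by rewrite mulr0 !mulr0z.
  by rewrite edge_map_comp // subsetUr.
by rewrite incidence_comp mulr0z.
Qed.

Lemma eq_differential u v t :
  (forall s, s \subset t -> u s = v s) -> differential u t = differential v t.
Proof.
move=> uv; rewrite !differentialE; apply: eq_bigr => s _.
have [->|/incidence_neq0[e _ tE]] := eqVneq (incidence s t) 0; first by rewrite !mulr0z.
by rewrite uv // tE subsetUr.
Qed.

(** Every set obtained from [e |: s] by removing an edge other than [e] still contains [e], so only
    the term at [s] survives. *)
Lemma differential_setU1 u s e : e \notin s ->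
  (forall s', s' \subset e |: s -> e \in s' -> u s' = 0) ->
  differential u (e |: s) = edge_map (e |: s) (u s) *~ edge_sign s e.
Proof.
move=> es u0; rewrite differentialE (bigD1 s) //= incidence_setU1 //.
rewrite big1 ?addr0 // => s' ne.
have [->|/incidence_neq0[f fs' E]] := eqVneq (incidence s' (e |: s)) 0.
  by rewrite mulr0z.
suff es' : e \in s' by rewrite u0 ?raddf0 ?mul0rz // E subsetUr.
have : e \in f |: s' by rewrite -E setU11.
rewrite in_setU1 => /predU1P[ef|//]; case/eqP: ne.
rewrite -ef in fs' E.
by rewrite -(setU1K fs') -E setU1K.
Qed.

Lemma in_degreeP (i : int) u :
  reflect (forall s, #|s|%:Z != i -> u s = 0) (in_degree i u).
Proof.
by apply: (iffP forallP) => h s;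
  [move=> si; apply/eqP/(implyP (h s)) | apply/implyP=> /h ->].
Qed.

Lemma in_degree_differential (i : int) u :
  in_degree (i - 1) u -> in_degree i (differential u).
Proof.
move=> /in_degreeP du; apply/in_degreeP => t ti; rewrite differentialE big1 // => s _.
have [->|/incidence_neq0[e es tE]] := eqVneq (incidence s t) 0; first by rewrite mulr0z.
rewrite du ?raddf0 ?mul0rz //; apply: contraNN ti => /eqP si.
by rewrite tE cardsU1 es; apply/eqP; lia.
Qed.

End Differential.

(** * Deletion and contraction *)

Section Exactness.
Variables (A : comPzRingType) (G : graph).
Implicit Types (s t S : {set edge G}) (x y z : G) (e f : edge G) (u v w : cochain A G).

Definition detach x y s t (L : component t) : component s :=
  component_of s (if connect (adj t) (val L) x then y else val L).

(* The factor of the component of x in t goes to the component of y, and the   *)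
(* components of [G : s] that are not reached receive the empty product 1.     *)
Definition detach_map x y s t : state_group A t -> state_group A s :=
  tensor_map (detach x y s (t := t)).

HB.instance Definition _ x y s t := GRing.Additive.on (@detach_map x y s t).

Lemma detach_mapK e x y s (a : state_group A (e |: s)) : joins e x y ->
  edge_map (e |: s) (detach_map x y s a) = a.
Proof.
move=> exy; rewrite /edge_map /detach_map tensor_map_comp -[RHS]tensor_map_id.
apply: eq_tensor_map => L /=; rewrite -[RHS]component_ofK; apply/eqP.
rewrite component_of_eq /detach.
apply: connect_trans (connect_adj_subset (subsetUr _ _) (connect_component_of _ _)) _.
case: ifP => [|_]; last exact: connect0.
rewrite connect_adj_sym => Lx; apply: connect_trans Lx.
by rewrite connect_adj_sym; apply: connect_joins exy _; rewrite setU11.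
Qed.

(** When the ends of [e] are already joined, adding [e] does not change the components, and
    [detach_map] inverts the edge map. *)
Lemma edge_map_inj e x y s : joins e x y -> connect (adj s) x y ->
  injective (edge_map (A := A) (s := s) (e |: s)).
Proof.
move=> exy xy.
suff K : cancel (edge_map (A := A) (s := s) (e |: s)) (detach_map x y s (t := e |: s)).
  exact: can_inj K.
move=> a.
rewrite /edge_map /detach_map tensor_map_comp -[RHS]tensor_map_id.
apply: eq_tensor_map => L /=; rewrite -[RHS]component_ofK; apply/eqP.
have cE z : connect (adj (e |: s)) z =1 connect (adj s) z.
  move=> z'; rewrite (connect_add_edge s exy).
  apply/or3P/idP => [[//||]|]; last by constructor.
    by case/andP=> zx; apply: connect_trans (connect_trans zx xy).
  by case/andP=> zy; apply: connect_trans (connect_trans zy _); rewrite connect_adj_sym.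
have LL : connect (adj s) (val (component_of (e |: s) (val L))) (val L).
  by rewrite -cE connect_component_of.
rewrite component_of_eq cE; case: ifP => // Lx.
by apply: connect_trans LL; rewrite connect_adj_sym; apply: connect_trans Lx xy.
Qed.

(* Cochains supported on the sets containing s0, up to their values on sets    *)
(* not contained in S, form the complex of [G : S] with s0 contracted.         *)
Definition supported s0 u := forall s, ~~ (s0 \subset s) -> u s = 0.

Definition exact_at s0 S (n : int) :=
  forall u, in_degree n u -> supported s0 u ->
    (forall t, t \subset S -> differential u t = 0) ->
  exists w, [/\ in_degree (n - 1) w, supported s0 w &
    forall t, t \subset S -> differential w t = u t].

Lemma supported_differential s0 u : supported s0 u -> supported s0 (differential u).
Proof.
move=> su t st; rewrite differentialE big1 // => s _.
have [->|/incidence_neq0[e es tE]] := eqVneq (incidence s t) 0; first by rewrite mulr0z.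
rewrite su ?raddf0 ?mul0rz //; apply: contraNN st => /subset_trans->//.
by rewrite tE subsetUr.
Qed.

(* A cocycle splits into a part exact on S :\ e and a part supported on the   *)
(* sets containing e.                                                          *)
Lemma exact_delete_supported s0 S e (n : int) : exact_at s0 (S :\ e) n ->
  (forall u, in_degree n u -> supported (e |: s0) u ->
     (forall t, t \subset S -> differential u t = 0) ->
   exists w, [/\ in_degree (n - 1) w, supported s0 w &
     forall t, t \subset S -> differential w t = u t]) ->
  exact_at s0 S n.
Proof.
move=> exD exC u du su u0.
have [t tS|w [dw sw wE]] := exD u du su.
  by apply: u0; apply: subset_trans tS (subD1set _ _).
(* Truncating to subsets of [S] makes the support condition hold on all sets. On [t \subset S]
   nothing is lost, since the differential at [t] reads only subsets of [t]. *)
pose u' : cochain A G := dsum_mk (fun s =>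
  if s \subset S then u s - differential w s else 0).
have u'E s : s \subset S -> u' s = (u - differential w) s by move=> sS; rewrite !ffunE sS.
have [|||w' [dw' sw' w'E]] := exC u'.
- apply/in_degreeP => s si; rewrite ffunE; case: ifP => // _.
  by rewrite (in_degreeP _ _ du) // (in_degreeP _ _ (in_degree_differential dw)) // subrr.
- move=> s; rewrite subUset sub1set negb_and => h; rewrite ffunE; case: ifP => // sS.
  have [s0s|s0s] := boolP (s0 \subset s); last first.
    by rewrite su // (supported_differential sw) // subrr.
  by rewrite wE ?subrr // subsetD1 sS; move: h; rewrite s0s orbF.
- move=> t tS; rewrite (@eq_differential _ _ _ (u - differential w)) => [|s st]; last first.
    by rewrite u'E // (subset_trans st).
  by rewrite raddfB /= differentialK subr0 u0.
exists (w + w'); split=> [|s s0s|t tS].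
- apply/in_degreeP => s si.
  by rewrite ffunE (in_degreeP _ _ dw) // (in_degreeP _ _ dw') // addr0.
- by rewrite ffunE sw // sw' // addr0.
- by rewrite raddfD ffunE /= w'E // u'E // dsumBE addrC subrK.
Qed.

(** The sets containing [e] span a subcomplex, the contraction, and the quotient by it is the
    deletion; this is the middle of the resulting long exact sequence. All degrees are those of the
    full complex, so the usual shift for the contraction is absorbed in [#|e |: s0|]. *)
Lemma exact_delete s0 S e (n : int) :
  exact_at s0 (S :\ e) n -> exact_at (e |: s0) S n -> exact_at s0 S n.
Proof.
move=> exD exC; apply: exact_delete_supported exD _ => u du su u0.
have [w [dw sw wE]] := exC u du su u0; exists w; split=> // s s0s; apply: sw.
by apply: contraNN s0s; apply: subset_trans; apply: subsetUr.
Qed.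

Lemma card_setU1_degree s e (n : int) :
  e \notin s -> #|s|%:Z != n - 1 -> #|e |: s|%:Z != n.
Proof.
by move=> es; apply: contraNN => /eqP <-; rewrite cardsU1 es addnC PoszD addrK.
Qed.

Lemma exact_loop s0 S e x y (n : int) : e \in S -> e \notin s0 -> joins e x y ->
  connect (adj s0) x y -> exact_at s0 S n.
Proof.
move=> eS es0 exy xy u du su u0.
(* This inverts the isomorphisms given by adding the loop [e]: [w] is chosen so that its
   differential agrees with [u] on every set containing [e]. *)
pose w : cochain A G := dsum_mk (fun s => if (e \notin s) && (s0 \subset s)
  then detach_map x y s (u (e |: s)) *~ edge_sign s e else 0).
have wE s : e \notin s -> s0 \subset s ->
    w s = detach_map x y s (u (e |: s)) *~ edge_sign s e.
  by move=> es s0s; rewrite ffunE es s0s.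
have w0 s : e \in s -> w s = 0 by move=> es; rewrite ffunE es.
have signK s : edge_sign s e * edge_sign s e = 1.
  by rewrite /edge_sign -exprMn mulrNN mulr1 expr1n.
have dw : in_degree (n - 1) w.
  apply/in_degreeP => s si; rewrite ffunE; case: ifP => // /andP[es _].
  by rewrite (in_degreeP _ _ du) ?raddf0 ?mul0rz //; exact: card_setU1_degree.
have sw : supported s0 w by move=> s s0s; rewrite ffunE (negbTE s0s) andbF.
have dwE t : e \in t -> differential w t = u t.
  move=> et; have et' : e \notin t :\ e by rewrite setD11.
  have [s0t|s0t] := boolP (s0 \subset t); last first.
    by rewrite su // (supported_differential sw).
  have s0t' : s0 \subset t :\ e by rewrite subsetD1 s0t.
  rewrite -(setD1K et) differential_setU1 // => [|s' _]; last exact: w0.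
  by rewrite wE // raddfMz /= detach_mapK // -mulrzA signK.
pose v := u - differential w.
have dv t : t \subset S -> differential v t = 0.
  by move=> tS; rewrite raddfB /= differentialK subr0 u0.
have v0 t : e \in t -> v t = 0 by move=> et; rewrite dsumBE dwE // subrr.
exists w; split=> // t tS; have [et|et] := boolP (e \in t); first exact: dwE.
have [s0t|s0t] := boolP (s0 \subset t); last first.
  by rewrite su // (supported_differential sw).
(* The remainder [v] vanishes on sets containing [e], so its closedness at [e |: t] says that the
   injective edge map kills [v t]. *)
have eq0 : edge_map (e |: t) (v t) *~ edge_sign t e = 0.
  rewrite -differential_setU1 // => [|s' _]; last exact: v0.
  by apply: dv; rewrite subUset sub1set eS.
have : v t = 0.
  apply: (edge_map_inj exy (connect_adj_subset s0t xy)).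
  by rewrite raddf0 -[LHS]mulr1z -(signK t) mulrzA eq0 mul0rz.
by rewrite dsumBE => /eqP; rewrite subr_eq0 => /eqP.
Qed.

End Exactness.

(** * Forests *)

Section Leaf.
Variables (A : comPzRingType) (G : graph).
Implicit Types (s t S : {set edge G}) (x y z : G) (e f : edge G) (u v w : cochain A G).

(** By the last hypothesis the [S]-component of [x] is already its [s0]-component, so [f] merges
    nothing into it. The factor 1 placed there by [detach_map] is therefore untouched when [f] is
    added. *)
Lemma edge_map_detach s0 S e f x y (a : state_group A (e |: s0)) :
  joins e x y -> f |: s0 \subset S -> e \notin S -> ~~ connect (adj S) x y ->
  (forall z, connect (adj S) x z -> connect (adj s0) x z) ->
  edge_map (f |: s0) (detach_map x y s0 a) =
  detach_map x y (f |: s0) (edge_map (e |: (f |: s0)) a).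
Proof.
move=> exy sS eS nxy leaf; set s := f |: s0.
have s0s : s0 \subset s := subsetUr _ _.
have xs z : connect (adj s) z x -> connect (adj (e |: s0)) z x.
  rewrite connect_adj_sym => zx; apply: (connect_adj_subset (subsetUr _ _)).
  by rewrite connect_adj_sym; apply/leaf/(connect_adj_subset sS).
have nsxy : ~~ connect (adj s) x y.
  by apply: contraNN nxy; apply: connect_adj_subset.
have mono z z' : connect (adj (e |: s0)) z z' -> connect (adj (e |: s)) z z'.
  by apply: connect_adj_subset; apply: setUS.
rewrite /edge_map /detach_map !tensor_map_comp; apply: eq_tensor_map => K /=.
set z := val K; set z' := val (component_of (e |: s) z).
have zz' : connect (adj (e |: s)) z' z := connect_component_of _ _.
rewrite {1}/detach; set z1 := if _ then _ else _.
apply/eqP; rewrite component_of_eq.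
apply: connect_trans (connect_adj_subset s0s (connect_component_of s0 z1)) _.
rewrite /z1 -/z -/z'; case: ifPn => [zx|nzx].
  by rewrite (connect_trans zz' (mono _ _ zx)) connect0.
have {zz'} zz' : connect (adj (e |: s)) z z' by rewrite connect_adj_sym.
have nzsx : ~~ connect (adj s) z x by apply: contraNN nzx; apply: xs.
case: ifPn => [z'x|nz'x].
  have : connect (adj (e |: s)) z x := connect_trans zz' z'x.
  rewrite (connect_add_edge s exy) (negbTE nzsx) /=.
  by rewrite connect_adj_sym => /andP[]; rewrite connect_adj_sym.
move: zz'; rewrite (connect_add_edge s exy) (negbTE nzsx) /=.
case/orP=> // /andP[_ xz']; case/negP: nz'x.
by rewrite connect_adj_sym; apply: connect_adj_subset xz'; apply: subsetUr.
Qed.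

(** Here [#|s0| + 1] is the lowest degree of the contraction of [e], where cohomology need not
    vanish, so [exact_delete] gives nothing. A splitting of the edge map of [e] takes its place. *)
Lemma exact_leaf s0 S e x y : e \in S -> e \notin s0 -> joins e x y ->
  ~~ connect (adj (S :\ e)) x y ->
  (forall z, connect (adj (S :\ e)) x z -> connect (adj s0) x z) ->
  exact_at A s0 (S :\ e) (#|s0|%:Z + 1) -> exact_at A s0 S (#|s0|%:Z + 1).
Proof.
move=> eS es0 exy nxy leaf /exact_delete_supported; apply=> u du su u0.
(* In this degree a cochain supported above [e |: s0] lives on that single set. *)
have uE s : s != e |: s0 -> u s = 0.
  move=> ne; have [es|es] := boolP (e |: s0 \subset s); last exact: su.
  apply: (in_degreeP _ _ du); apply: contraNN ne => /eqP ds.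
  by rewrite eq_sym eqEcard es cardsU1 es0; lia.
pose w : cochain A G := dsum_mk (fun s => if s == s0
  then detach_map x y s (u (e |: s)) *~ edge_sign s e else 0).
have w0 s : s != s0 -> w s = 0 by move=> ne; rewrite ffunE (negbTE ne).
have wE : w s0 = detach_map x y s0 (u (e |: s0)) *~ edge_sign s0 e by rewrite ffunE eqxx.
have signK s f : edge_sign s f * edge_sign s f = 1.
  by rewrite /edge_sign -exprMn mulrNN mulr1 expr1n.
have dwE : differential w (e |: s0) = u (e |: s0).
  have w0e s' : s' \subset e |: s0 -> e \in s' -> w s' = 0.
    by move=> _ es'; apply: w0; apply: contraNN es0 => /eqP <-.
  rewrite (differential_setU1 es0 w0e) wE edge_mapMz (detach_mapK _ exy).
  by rewrite -mulrzA signK mulr1z.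
exists w; split=> [|s s0s|t tS].
- apply/in_degreeP => s si; apply: w0; apply: contraNN si => /eqP ->.
  by apply/eqP; rewrite addrK.
- by apply: w0; apply: contraNN s0s => /eqP ->.
have [->|ne] := eqVneq t (e |: s0); first exact: dwE.
rewrite uE // differentialE (bigD1 s0) //= [X in _ + X]big1 ?addr0; last first.
  by move=> s /w0 ->; rewrite raddf0 mul0rz.
have [->|/incidence_neq0[f fs0 tE]] := eqVneq (incidence s0 t) 0; first by rewrite mulr0z.
have fe : f != e by apply: contraNN ne; rewrite tE => /eqP ->.
have fS : f |: s0 \subset S :\ e.
  by rewrite subsetD1 -tE tS tE in_setU1 (negbTE es0) orbF eq_sym.
have fe0 : f \notin e |: s0 by rewrite in_setU1 negb_or fe.
(* At [f |: s0] the differential of [w] is, up to sign, the detached image of the value of [u]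
   pushed along [f]. That push is zero, because [u] is closed at [f |: (e |: s0)]. *)
rewrite wE edge_mapMz tE (@edge_map_detach _ (S :\ e)) ?setD11 //.
suff -> : edge_map (e |: (f |: s0)) (u (e |: s0)) = 0 by rewrite raddf0 !mul0rz.
have fet : f |: (e |: s0) \subset S by rewrite setUCA subUset sub1set eS -tE.
have u0f s' : s' \subset f |: (e |: s0) -> f \in s' -> u s' = 0.
  by move=> _ fs'; apply: uE; apply: contraNN fe0 => /eqP <-.
have H := u0 _ fet; rewrite (differential_setU1 fe0 u0f) in H.
by rewrite setUCA -[LHS]mulr1z -(signK (e |: s0) f) mulrzA H mul0rz.
Qed.

End Leaf.

Section Bridges.
Variable G : graph.
Implicit Types (s t S : {set edge G}) (x y z : G) (e f : edge G).

(** These are the edges of [[G : S]] lying on a cycle, loops included. *)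
Definition nonbridge S e : bool :=
  (e \in S) && connect (adj (S :\ e)) (ends e).1 (ends e).2.

Lemma nonbridgeE S e x y : joins e x y ->
  nonbridge S e = (e \in S) && connect (adj (S :\ e)) x y.
Proof.
move=> exy; rewrite /nonbridge; congr (_ && _).
by case/orP: (joins_eq exy (joins_ends e)) => /andP[/eqP-> /eqP->] //; rewrite connect_adj_sym.
Qed.

Lemma nonbridge_subset s S e : s \subset S -> nonbridge s e -> nonbridge S e.
Proof.
move=> sS /andP[es conn]; rewrite /nonbridge (subsetP sS) //=.
by apply: connect_adj_subset conn; apply: setSD.
Qed.

(* A bridge e and an end x of it for which the component of x in S :\ e is    *)
(* smallest possible: any other edge of S :\: s0 meeting that component would  *)
(* cut off a smaller one.                                                      *)
Lemma forest_leaf s0 S : ~~ (S \subset s0) ->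
  (forall e, e \in S -> e \notin s0 -> ~~ nonbridge S e) ->
  exists e x y, [/\ e \in S, e \notin s0, joins e x y,
    ~~ connect (adj (S :\ e)) x y &
    forall z, connect (adj (S :\ e)) x z -> connect (adj s0) x z].
Proof.
move=> /subsetPn[e0 e0S e0s0] bridges.
pose P (p : edge G * (G * G)) :=
  [&& p.1 \in S, p.1 \notin s0 & joins p.1 p.2.1 p.2.2].
pose M (p : edge G * (G * G)) := #|connect (adj (S :\ p.1)) p.2.1|.
have P0 : P (e0, ((ends e0).1, (ends e0).2)) by rewrite /P e0S e0s0 joins_ends.
case: (arg_minnP M P0) => -[e [x y]]; rewrite {1}/P /= => /and3P[eS es0 exy] minM.
have nxy : ~~ connect (adj (S :\ e)) x y.
  by have := bridges e eS es0; rewrite (nonbridgeE _ exy) eS.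
have noedge f a b : f \in S -> f \notin s0 -> f != e -> joins f a b ->
    ~~ connect (adj (S :\ e)) x a.
  move=> fS fs0 fe fab; apply/negP => xa.
  have xb : connect (adj (S :\ e)) x b.
    by apply: connect_trans xa (connect_joins fab _); rewrite in_setD1 fe.
  have nab : ~~ connect (adj (S :\ f)) a b.
    by have := bridges f fS fs0; rewrite (nonbridgeE _ fab) fS.
  (* As [f] is a bridge, removing it separates at least one of its ends from [x]; call that end
     [b]. *)
  wlog nbx : a b fab xa xb nab / ~~ connect (adj (S :\ f)) b x => [W|].
    have [bx|] := boolP (connect (adj (S :\ f)) b x); last exact: W fab xa xb nab.
    apply: (W b a) => //; first by rewrite joins_sym.
      by rewrite connect_adj_sym.
    by apply: contraNN nab => ax; apply: connect_trans ax _; rewrite connect_adj_sym.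
  have Pf : P (f, (b, a)) by rewrite /P fS fs0 joins_sym.
  have := minM _ Pf; rewrite leqNgt => /negP; apply; apply: proper_card.
  have SfE : S :\ f = e |: (S :\ f :\ e) by rewrite setD1K // in_setD1 eq_sym fe.
  have exS : connect (adj (S :\ f)) y x.
    by rewrite connect_adj_sym; apply: connect_joins exy _; rewrite in_setD1 eq_sym fe.
  have mono z z' : connect (adj (S :\ f :\ e)) z z' -> connect (adj (S :\ f)) z z'.
    by apply: connect_adj_subset; apply: subD1set.
  (* A walk from [b] avoiding [f] cannot use [e], both of whose ends are joined to [x] without [f].
     It thus stays in the component of [x] in [S :\ e] and misses [x], contradicting minimality. *)
  apply/properP; split; last by exists x; [exact: connect0 | exact: nbx].
  apply/subsetP => z; rewrite -[_ \in _]/(connect (adj (S :\ f)) b z) => bz.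
  rewrite -[_ \in _]/(connect (adj (S :\ e)) x z).
  move: (bz); rewrite SfE (connect_add_edge _ exy) => /or3P[h|/andP[/mono h _]|/andP[/mono h _]].
  - apply: connect_trans xb (connect_adj_subset _ h).
    by rewrite setDDl setUC -setDDl subD1set.
  - by rewrite h in nbx.
  - by rewrite (connect_trans h exS) in nbx.
exists e, x, y; split=> // z /connectP[p].
elim/last_ind: p z => [|p a IHp] z; first by move=> _ ->; apply: connect0.
rewrite rcons_path last_rcons => /andP[pth /existsP[f /andP[fS fa]]] ->.
have xl : connect (adj (S :\ e)) x (last x p) by apply/connectP; exists p.
apply: connect_trans (IHp _ pth erefl) _; apply: (connect_joins fa).
move: fS; rewrite in_setD1 => /andP[fe fS].
by apply: contraTT xl => fs0; exact: noedge fa.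
Qed.

End Bridges.

(** Induction on the number of uncontracted edges. The first positive degree of the contracted graph
    is handled by a leaf, all higher ones by deletion and contraction. *)
Lemma exact_forest (A : comPzRingType) (G : graph) (s0 S : {set edge G}) (n : int) :
  s0 \subset S -> (forall e, e \in S -> e \notin s0 -> ~~ nonbridge S e) ->
  #|s0|%:Z < n -> exact_at A s0 S n.
Proof.
have [m] := ubnP #|S :\: s0|; elim: m s0 S n => // m IHm s0 S n Sm s0S bridges n_gt.
have [Ss0|] := boolP (S \subset s0).
  move=> u du su u0; exists 0; split=> [||t tS].
  - exact: in_degree0.
  - by move=> s _; rewrite dsum0E.
  rewrite raddf0 dsum0E; have [s0t|/su->//] := boolP (s0 \subset t).
  have tE : t = s0 by apply/eqP; rewrite eqEsubset s0t (subset_trans tS).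
  by rewrite (in_degreeP _ _ du) // tE; lia.
case/forest_leaf=> // e [x [y [eS es0 exy nxy leaf]]].
have SeS : S :\ e \subset S := subD1set _ _.
have bound : (#|(S :\ e) :\: s0| < m)%N.
  move: Sm; rewrite (cardsD1 e) in_setD es0 eS add1n ltnS.
  by rewrite !setDDl setUC.
have exD k : #|s0|%:Z < k -> exact_at A s0 (S :\ e) k.
  apply: IHm => // [|f].
    by rewrite subsetD1 s0S.
  rewrite in_setD1 => /andP[fe fS] fs0.
  by apply: contraNN (bridges f fS fs0); apply: nonbridge_subset.
have [->|n_ne] := eqVneq n (#|s0|%:Z + 1).
  by apply: (exact_leaf eS es0 exy nxy leaf); apply: exD; rewrite ltrDl.
apply: (exact_delete (exD _ n_gt)); apply: IHm.
- by rewrite -setDDl.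
- by rewrite subUset sub1set eS.
- by move=> f fS; rewrite in_setU1 negb_or => /andP[_]; exact: bridges.
- by rewrite cardsU1 es0; lia.
Qed.

(** * The vanishing bound *)

Section CountComponents.
Variable G : graph.
Implicit Types (s t S : {set edge G}) (x y z : G) (e f : edge G) (U C : {set G}).

(** This counts the components of [[G : s]] that meet [U]. For [s = s0] it is the number of vertices
    of [U] after contraction. *)
Definition ncomp s U : nat := #|[set fingraph.root (adj s) x | x in U]|.

Lemma root_adj_eq s x y :
  (fingraph.root (adj s) x == fingraph.root (adj s) y) = connect (adj s) x y.
Proof. by rewrite root_connect //; exact: adj_connect_sym. Qed.

Lemma root_adj_subset s t x : s \subset t ->
  fingraph.root (adj t) (fingraph.root (adj s) x) = fingraph.root (adj t) x.
Proof.
move=> st; apply/eqP; rewrite root_adj_eq connect_adj_sym.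
by apply: connect_adj_subset st _; apply: connect_root.
Qed.

Lemma ncomp_subset s t U : s \subset t -> (ncomp t U <= ncomp s U)%N.
Proof.
move=> st; rewrite /ncomp -(eq_imset _ (fun x => root_adj_subset x st)).
by rewrite (imset_comp (fingraph.root (adj t))) leq_imset_card.
Qed.

Lemma ncomp0 s : ncomp s finset.set0 = 0%N.
Proof. by rewrite /ncomp imset0 cards0. Qed.

Lemma n_comp_ncomp s U :
  (forall x y, x \in U -> connect (adj s) x y -> y \in U) ->
  n_comp (adj s) U = ncomp s U.
Proof.
move=> clU; rewrite /n_comp_mem /ncomp; apply: eq_card => r; rewrite !inE.
apply/andP/imsetP => [[/eqP rr rU]|[x xU ->]]; first by exists r.
split; first exact/roots_root/adj_connect_sym.
by apply: clU xU _; apply: connect_root.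
Qed.

Lemma ncomp_set0 U : ncomp finset.set0 U = #|U|.
Proof.
rewrite /ncomp card_in_imset // => x y _ _ /eqP; rewrite root_adj_eq.
case/connectP=> -[|z p] //= /andP[/existsP[e]]; by rewrite inE.
Qed.

Lemma ncomp_contract s e x y U : joins e x y -> x \in U -> y \in U ->
  ~~ connect (adj s) x y -> (ncomp (e |: s) U < ncomp s U)%N.
Proof.
move=> exy xU yU nxy; set R := [set fingraph.root (adj s) x | x in U].
have yR : fingraph.root (adj s) y \in R by apply: imset_f.
have ses : s \subset e |: s := subsetUr _ _.
rewrite [ltnRHS](cardsD1 (fingraph.root (adj s) y)) yR ltnS /ncomp.
apply: leq_trans (leq_imset_card (fingraph.root (adj (e |: s))) _).
apply/subset_leq_card/subsetP => _ /imsetP[z zU ->].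
have [zy|nzy] := boolP (connect (adj s) z y).
  apply/imsetP; exists (fingraph.root (adj s) x).
    by rewrite in_setD1 root_adj_eq nxy imset_f.
  rewrite root_adj_subset //; apply/eqP; rewrite root_adj_eq.
  apply: connect_trans (connect_adj_subset ses zy) _.
  by rewrite connect_adj_sym; apply: connect_joins exy _; rewrite setU11.
apply/imsetP; exists (fingraph.root (adj s) z); last by rewrite root_adj_subset.
by rewrite in_setD1 root_adj_eq nzy imset_f.
Qed.

(** Source of the factor 2 in the bound: a discarded component [C] contains at least two contracted
    vertices, those of [x] and [y]. *)
Lemma ncompD2 s x y U C : x \in U -> y \in U -> x \in C -> y \in C ->
  (forall z z', z \in C -> connect (adj s) z z' -> z' \in C) ->
  ~~ connect (adj s) x y -> ((ncomp s (U :\: C)).+2 <= ncomp s U)%N.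
Proof.
move=> xU yU xC yC clC nxy; rewrite /ncomp.
set R := [set fingraph.root (adj s) x | x in U].
have xR : fingraph.root (adj s) x \in R by apply: imset_f.
have yR : fingraph.root (adj s) y \in R :\ fingraph.root (adj s) x.
  by rewrite in_setD1 root_adj_eq connect_adj_sym nxy imset_f.
rewrite (cardsD1 (fingraph.root (adj s) x) R) xR.
rewrite (cardsD1 (fingraph.root (adj s) y) (R :\ _)) yR !add1n !ltnS.
apply/subset_leq_card/subsetP => _ /imsetP[z /finset.setDP[zU zC] ->].
by rewrite !in_setD1 !root_adj_eq imset_f // andbT; apply/andP; split;
  apply: contraNN zC; rewrite connect_adj_sym; apply: clC.
Qed.

Lemma ncompD1 s x U C : (forall z, z \in C -> connect (adj s) x z) ->
  (ncomp s U <= (ncomp s (U :\: C)).+1)%N.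
Proof.
move=> Cx; rewrite /ncomp -add1n -(cards1 (fingraph.root (adj s) x)).
apply: leq_trans (leq_card_setU _ _); apply/subset_leq_card/subsetP => _ /imsetP[z zU ->].
rewrite in_setU in_set1 root_adj_eq; have [zC|zC] := boolP (z \in C).
  by rewrite connect_adj_sym Cx.
by rewrite imset_f ?orbT // in_setD zC.
Qed.

Lemma connect_nonbridge S e : nonbridge S e ->
  connect (adj (S :\ e)) =2 connect (adj S).
Proof.
move=> /andP[eS xy] u v; apply/idP/idP.
  by apply: connect_adj_subset; apply: subD1set.
rewrite -{1}(setD1K eS) (connect_add_edge _ (joins_ends e)).
case/or3P=> [//|/andP[ux yv]|/andP[uy xv]].
  exact: connect_trans ux (connect_trans xy yv).
by apply: connect_trans uy (connect_trans _ xv); rewrite connect_adj_sym.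
Qed.

(* The other edges of a cycle through e outside s0 survive, by minimality of a *)
(* set of edges joining the ends of e.                                         *)
Lemma nonbridge_contract s0 S e x y : s0 \subset S -> e \notin s0 -> joins e x y ->
  nonbridge S e -> ~~ connect (adj s0) x y ->
  exists f, [/\ f \in S, f \notin e |: s0, nonbridge S f &
    connect (adj S) x (ends f).1].
Proof.
move=> s0S es0 exy; rewrite (nonbridgeE _ exy) => /andP[eS xy] nxy.
pose P (T : {set edge G}) := [&& s0 \subset T, T \subset S :\ e & connect (adj T) x y].
have PS : P (S :\ e) by rewrite /P subsetD1 s0S es0 fintype.subxx.
(* Minimality makes every edge [f] of [T] outside [s0] indispensable: each connection from [x] to
   [y] in [T] crosses [f]. Going back through [e] then joins [x] to both ends of [f] without [f]. *)
case: (arg_minnP (fun T : {set edge G} => #|T|) PS) => T /and3P[s0T TS Txy] minT.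
have /subsetPn[f fT fs0] : ~~ (T \subset s0).
  by apply: contraNN nxy => Ts0; apply: connect_adj_subset Ts0 Txy.
have := subsetP TS _ fT; rewrite in_setD1 => /andP[fe fS].
have Tf : T :\ f \subset S :\ f by apply/setSD/(subset_trans TS)/subD1set.
have TfS z z' : connect (adj (T :\ f)) z z' -> connect (adj (S :\ f)) z z'.
  exact: connect_adj_subset.
have nTf : ~~ connect (adj (T :\ f)) x y.
  apply/negP => Tfxy; have := minT (T :\ f).
  rewrite /P Tfxy subsetD1 s0T fs0 (subset_trans (subD1set _ _) TS) => /(_ isT).
  by rewrite [X in (X <= _)%N](cardsD1 f) fT ltnn.
have Sxy : connect (adj (S :\ f)) x y.
  by apply: connect_joins exy _; rewrite in_setD1 eq_sym fe.
have [] : connect (adj (S :\ f)) x (ends f).1 /\ connect (adj (S :\ f)) x (ends f).2.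
  move: Txy; rewrite -(setD1K fT) (connect_add_edge _ (joins_ends f)) (negbTE nTf) /=.
  by case/orP => /andP[/TfS xa /TfS by']; split=> //; apply: connect_trans Sxy _;
    rewrite connect_adj_sym.
move=> xa xb; exists f; split=> //.
- by rewrite in_setU1 negb_or fe.
- by rewrite /nonbridge fS; apply: connect_trans xb; rewrite connect_adj_sym.
- by apply: connect_adj_subset xa; apply: subD1set.
Qed.

(** Deleting [e] only affects its own component, and [f] lies in another one. *)
Lemma nonbridge_delete S e f x : e \in S -> nonbridge S f -> x = (ends e).1 ->
  ~~ connect (adj S) x (ends f).1 -> nonbridge (S :\ e) f.
Proof.
move=> eS /andP[fS ab] xE nxa.
have fe : f != e.
  by apply: contraNN nxa => /eqP ->; rewrite xE connect0.
have mono z z' : connect (adj (S :\ f :\ e)) z z' -> connect (adj S) z z'.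
  by apply: connect_adj_subset; rewrite setDDl subDset subsetUr.
rewrite /nonbridge in_setD1 fe fS /= setDDl setUC -setDDl.
move: ab; rewrite -{1}(@setD1K _ e (S :\ f)) ?in_setD1 1?eq_sym ?fe //.
rewrite (connect_add_edge _ (joins_ends e)).
case/or3P=> [//|/andP[/mono ax _]|/andP[/mono ay _]].
  by case/negP: nxa; rewrite connect_adj_sym xE.
case/negP: nxa; rewrite connect_adj_sym; apply: connect_trans ay _.
by rewrite connect_adj_sym xE; apply: connect_joins (joins_ends e) _.
Qed.

End CountComponents.

(** The three conditions on [U] say that it is the union of the components of [[G : S]] containing a
    non-bridge outside [s0], the cyclic part of the contracted graph. *)
Lemma exact_above (A : comPzRingType) (G : graph) (s0 S : {set edge G})
    (U : {set G}) (n : int) :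
  s0 \subset S ->
  (forall x y, x \in U -> connect (adj S) x y -> y \in U) ->
  (forall e, e \in S -> e \notin s0 -> (ends e).1 \notin U -> ~~ nonbridge S e) ->
  (forall x, x \in U -> exists e, [/\ e \in S, e \notin s0, nonbridge S e &
    connect (adj S) x (ends e).1]) ->
  #|s0|%:Z + (ncomp s0 U)%:Z - 2 * (ncomp S U)%:Z < n -> exact_at A s0 S n.
Proof.
have [m] := ubnP #|S :\: s0|; elim: m s0 S U => // m IHm s0 S U Sm s0S clU offU onU n_gt.
have [U0|[x0 x0U]] := finset.set_0Vmem U.
  apply: exact_forest => // [e eS es0|]; first by apply: offU => //; rewrite U0 inE.
  by move: n_gt; rewrite U0 !ncomp0; clear; lia.
have [e [eS es0 nbe x0e]] := onU _ x0U.
set x := (ends e).1 in x0e; set y := (ends e).2.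
have exy : joins e x y := joins_ends e.
have xU : x \in U := clU _ _ x0U x0e.
have xyS : connect (adj S) x y by apply: connect_joins exy _.
have yU : y \in U := clU _ _ xU xyS.
have [xy|nxy] := boolP (connect (adj s0) x y); first exact: exact_loop eS es0 exy xy.
have bound : (#|S :\: (e |: s0)| < m)%N.
  by move: Sm; rewrite (cardsD1 e) in_setD es0 eS add1n ltnS setDDl setUC.
have conE := connect_nonbridge nbe.
pose C := [set z | connect (adj S) x z].
have inC z : (z \in C) = connect (adj S) x z by rewrite inE.
have clC z z' : z \in C -> connect (adj S) z z' -> z' \in C.
  by rewrite !inC; apply: connect_trans.
have onUC z : z \in U -> z \notin C -> exists f, [/\ f \in S :\ e, f \notin s0,
    nonbridge (S :\ e) f & connect (adj S) z (ends f).1].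
  move=> zU zC; have [f [fS fs0 nbf zf]] := onU z zU.
  have xf : ~~ connect (adj S) x (ends f).1.
    by apply: contraNN zC => xf; rewrite inC (connect_trans xf) // connect_adj_sym.
  exists f; split=> //; last exact: nonbridge_delete eS nbf erefl xf.
  by rewrite in_setD1 fS andbT; apply: contraNN xf => /eqP ->; apply: connect0.
have SeS : S :\ e \subset S := subD1set _ _.
apply: (@exact_delete _ _ _ _ e).
  have s0Se : s0 \subset S :\ e by rewrite subsetD1 s0S.
  have bound' : (#|(S :\ e) :\: s0| < m)%N by rewrite setDDl.
  have off' f : f \in S :\ e -> f \notin s0 ->
      (ends f).1 \notin U -> ~~ nonbridge (S :\ e) f.
    rewrite in_setD1 => /andP[fe fS] fs0 /(offU f fS fs0); apply: contraNN.
    exact: nonbridge_subset.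
  (* Deletion: either the component [C] of [e] keeps a cycle and [U] stays, or [C] has become a tree
     after contraction and is removed from [U]. *)
  have [f /and4P[fS fs0 nbf xf]|nof] := pickP (fun f => [&& f \in S :\ e, f \notin s0,
      nonbridge (S :\ e) f & connect (adj S) x (ends f).1]).
    apply: (IHm _ _ U) => // [z z' zU|z zU|].
    - by rewrite conE; apply: clU.
    - have [zC|zC] := boolP (z \in C); last first.
        by have [f' [? ? ? zf']] := onUC z zU zC; exists f'; rewrite conE.
      exists f; split=> //; rewrite conE; apply: connect_trans xf.
      by rewrite connect_adj_sym -inC.
    - have le_bound (a b c c' : nat) : (c <= c')%N ->
        a%:Z + b%:Z - 2 * c%:Z < n -> a%:Z + b%:Z - 2 * c'%:Z < n by clear; lia.
      exact: le_bound (ncomp_subset U SeS) n_gt.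
  apply: (IHm _ _ (U :\: C)) => // [z z'|f fS fs0|z|].
  - rewrite conE !in_setD => /andP[zC zU] zz'; rewrite (clU z) // andbT.
    by apply: contraNN zC => z'C; apply: clC z'C _; rewrite connect_adj_sym.
  - rewrite in_setD negb_and negbK => /orP[fC|]; last exact: off'.
    by move: (nof f); rewrite fS fs0 -inC fC andbT => /negbT.
  - rewrite in_setD => /andP[zC zU].
    by have [f' [? ? ? zf']] := onUC z zU zC; exists f'; rewrite conE.
  have C1 : (ncomp S U <= (ncomp S (U :\: C)).+1)%N.
    by apply: (@ncompD1 _ _ x) => z; rewrite inC.
  have C2 : ((ncomp s0 (U :\: C)).+2 <= ncomp s0 U)%N.
    apply: (ncompD2 xU yU) nxy; rewrite ?inC ?connect0 // => z z' zC.
    by move/(connect_adj_subset s0S); apply: clC.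
  have le_bound (a b b' c c1 c' : nat) :
    (c <= c1.+1)%N -> (b'.+2 <= b)%N -> (c1 <= c')%N ->
    a%:Z + b%:Z - 2 * c%:Z < n -> a%:Z + b'%:Z - 2 * c'%:Z < n by clear; lia.
  exact: le_bound C1 C2 (ncomp_subset (U :\: C) SeS) n_gt.
(* Contraction: [U] stays, since the rest of a cycle through [e] provides a non-bridge outside
   [e |: s0]. *)
apply: (IHm _ _ U) => // [|f fS|z zU|].
- by rewrite subUset sub1set eS.
- by rewrite in_setU1 negb_or => /andP[_]; apply: offU.
- have [zC|zC] := boolP (z \in C).
    have [f [fS fs0 nbf xf]] := nonbridge_contract s0S es0 exy nbe nxy.
    by exists f; split=> //; apply: connect_trans xf; rewrite connect_adj_sym -inC.
  have [f [fS fs0 nbf zf]] := onUC z zU zC.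
  exists f; split=> //.
  + exact: (subsetP SeS).
  + by move: fS; rewrite in_setD1 in_setU1 negb_or => /andP[->].
  + exact: nonbridge_subset nbf.
have le_bound (a b b' c : nat) : (b' < b)%N ->
  a%:Z + b%:Z - 2 * c%:Z < n -> (true + a)%:Z + b'%:Z - 2 * c%:Z < n by clear; lia.
rewrite cardsU1 es0; exact: le_bound (ncomp_contract exy xU yU nxy) n_gt.
Qed.

(** * Cycles *)

Section Cycles.
Variable G : graph.
Implicit Types (s : {set edge G}) (x y z : G) (e f : edge G) (p : seq G).
Let step (q r : G * edge G) := joins q.2 q.1 r.1.

Lemma connect_step s q r (c : seq (G * edge G)) :
  path step q (rcons c r) -> {subset unzip2 (q :: c) <= s} ->
  connect (adj s) q.1 r.1.
Proof.
elim: c q => [|q' c IHc] q /= => [/andP[qr _] sub|/andP[qq' pth] sub].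
  by apply: connect_joins qr _; apply: sub; rewrite inE eqxx.
apply: connect_trans (connect_joins qq' _) (IHc _ pth _) => [|f fc].
  by apply: sub; rewrite inE eqxx.
by apply: sub; rewrite inE fc orbT.
Qed.

(** The edge leaving [y] occurs once in the cycle, so the remaining edges join its ends. *)
Lemma cycle_nonbridge (c : seq (G * edge G)) y : is_cycle c -> y \in unzip1 c ->
  exists2 e, nonbridge [set: edge G] e & connect (adj [set: edge G]) y (ends e).1.
Proof.
case/and4P=> _ uc1 uc2 cyc /mapP[[y' e] yc /= ->] {y}.
case: (rot_to yc) => i c' rotE.
have : uniq (unzip2 (rot i c)) by rewrite /unzip2 map_rot rot_uniq.
rewrite -(rot_cycle i) rotE in cyc *; rewrite /= => /andP[ec' _].
have sub : {subset unzip2 c' <= [set: edge G] :\ e}.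
  by move=> f fc'; rewrite !inE andbT; apply: contraNneq ec' => <-.
have [z [eyz zy]] : exists z, joins e y' z /\ connect (adj ([set: edge G] :\ e)) z y'.
  case: c' {rotE ec'} cyc sub => [|q c'] /= /andP[eyq pth] sub.
    by exists y'; rewrite connect0.
  by exists q.1; split=> //; apply: (connect_step (r := (y', e)) pth).
exists e; first by rewrite (nonbridgeE _ eyz) inE connect_adj_sym.
case/orP: (joins_eq eyz (joins_ends e)) => /andP[/eqP-> _]; first exact: connect0.
by apply: connect_joins eyz _; rewrite inE.
Qed.

Section Walk.
Variables (s : {set edge G}) (e0 : edge G).

(** The default [e0] is returned only for non-adjacent vertices. *)
Let edge_from x y := odflt e0 [pick f in s | joins f x y].

Let edge_fromP x y : adj s x y -> edge_from x y \in s /\ joins (edge_from x y) x y.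
Proof.
case/existsP=> f fP; rewrite /edge_from.
by case: pickP => [f' /andP[]|/(_ f)] //; rewrite fP.
Qed.

Fixpoint walk x p : seq (G * edge G) :=
  if p is y :: p' then (x, edge_from x y) :: walk y p' else [::].

Lemma unzip1_walk x p : unzip1 (walk x p) = belast x p.
Proof. by elim: p x => //= y p IHp x; rewrite IHp. Qed.

Lemma path_walk x p q r : path (adj s) x p -> joins q.2 q.1 x -> last x p = r.1 ->
  path step q (rcons (walk x p) r).
Proof.
elim: p x q => [|y p IHp] x q /=; first by move=> _ qx xE; rewrite /step -xE qx.
case/andP=> /edge_fromP[_ xy] pth qx lst; rewrite {1}/step qx /=.
exact: IHp.
Qed.

Lemma walk_edges x p f : path (adj s) x p -> f \in unzip2 (walk x p) ->
  f \in s /\ exists y z, [/\ y \in x :: p, z \in x :: p & joins f y z].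
Proof.
elim: p x => //= y p IHp x /andP[/edge_fromP[xs xy] pth].
rewrite inE => /predU1P[->|/IHp[//|fs [a [b [ap bp fab]]]]].
  by split=> //; exists x, y; split; rewrite // !inE eqxx ?orbT.
by split=> //; exists a, b; rewrite inE ap inE bp !orbT.
Qed.

(** A repetition of the first edge would put its end [x] on the rest of the simple path. *)
Lemma uniq_walk x p : path (adj s) x p -> uniq (x :: p) -> uniq (unzip2 (walk x p)).
Proof.
elim: p x => //= y p IHp x /andP[/edge_fromP[_ xy] pth] /andP[xp up].
rewrite IHp // andbT; apply/negP => /(walk_edges pth)[_ [a [b [ap bp fab]]]].
case/negP: xp; case/orP: (joins_eq fab xy) => /andP[/eqP -> _] //.
Qed.

End Walk.

Lemma nonbridge_cycle e : nonbridge [set: edge G] e ->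
  exists2 c : seq (G * edge G), is_cycle c & (ends e).1 \in unzip1 c.
Proof.
case/andP=> _; rewrite connect_adj_sym => /connectP[p0 /shortenP[p pth up _] lst].
set a := (ends e).1 in lst *; set b := (ends e).2 in pth up lst.
exists ((a, e) :: walk ([set: edge G] :\ e) e b p); last by rewrite inE eqxx.
rewrite /is_cycle /= unzip1_walk uniq_walk // andbT.
apply/and3P; split.
- by move: up; rewrite lastI rcons_uniq -lst.
- by apply/negP => /(walk_edges pth)[]; rewrite !inE eqxx.
- by apply: path_walk => //=; apply: joins_ends.
Qed.

Lemma nontree_partP x :
  reflect
    (exists2 e, nonbridge [set: edge G] e &
       connect (adj [set: edge G]) x (ends e).1)
    (x \in nontree_part G).
Proof.
rewrite !inE; apply: (iffP idP) => [/asboolPn/existsNP[c]|[e nbe xe]].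
  rewrite not_implyE => -[cyc /existsNP[y]]; rewrite not_implyE => -[yc /negP].
  rewrite negbK => xy; have [e nbe ye] := cycle_nonbridge cyc yc.
  by exists e => //; apply: connect_trans xy ye.
apply/asboolPn => tree; have [c cyc ec] := nonbridge_cycle nbe.
by move/negP: (tree c cyc _ ec); apply.
Qed.

End Cycles.

Lemma exact_above_nontree (A : comPzRingType) (G : graph) (n : int) :
  #|nontree_part G|%:Z - 2 * (num_components (nontree_part G))%:Z < n ->
  exact_at A finset.set0 [set: edge G] n.
Proof.
have clU (x y : G) : x \in nontree_part G ->
    connect (adj [set: edge G]) x y -> y \in nontree_part G.
  move=> /nontree_partP[e nbe xe] xy; apply/nontree_partP; exists e => //.
  by apply: connect_trans xe; rewrite connect_adj_sym.
rewrite /num_components n_comp_ncomp // => n_gt.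
apply: (exact_above (U := nontree_part G)) => // [e _ _|x /nontree_partP[e nbe xe]|].
- by apply: contraNN => nbe; apply/nontree_partP; exists e; rewrite ?connect0.
- by exists e; rewrite !inE.
- by rewrite ncomp_set0 cards0 add0r.
Qed.

(** * Torsion in tensor powers *)

Section TensorTorsionFree.
Variables (A : comPzRingType) (I : finType).

(** Universal property with values in the integers; the map is additive once [g] is additive in each
    argument. *)
Definition tensor_lift (g : {ffun I -> A} -> int) (t : tensor A I) : int :=
  fglift (g : _ -> int^o) (tensor_repr t).

Section Lift.
Variable g : {ffun I -> A} -> int.
Hypothesis gD : forall a i x y, g (upd a i (x + y)) = g (upd a i x) + g (upd a i y).

Let lift : {freeg {ffun I -> A}} -> int := fglift (g : _ -> int^o).

Let liftB : zmod_morphism lift.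
Proof. exact: (@lift_is_additive _ _ int^o g). Qed.

Let lift_gen a : lift (gen a) = g a.
Proof. by rewrite /lift /gen liftU scale1r. Qed.

Let lift_rel u : tensor_rel u -> lift u = 0.
Proof.
elim=> [|{}u v _ ru _ rv|a i x y].
- by rewrite -(subrr 0) liftB subrr.
- by rewrite liftB ru rv subrr.
- by rewrite !liftB !lift_gen gD addrAC addrK subrr.
Qed.

Let tensor_lift_pi u : tensor_lift g (tensor_pi u) = lift u.
Proof.
apply/eqP; rewrite -subr_eq0 -[X in X == _]liftB; apply/eqP/lift_rel.
by apply/tensor_pi_eq; apply: tensor_reprK.
Qed.

Lemma tensor_lift_pure a : tensor_lift g (pure a) = g a.
Proof. by rewrite tensor_lift_pi lift_gen. Qed.

Lemma tensor_lift_is_zmod_morphism : zmod_morphism (tensor_lift g).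
Proof.
move=> s t; rewrite -[s]tensor_reprK -[t]tensor_reprK -raddfB !tensor_lift_pi.
exact: liftB.
Qed.

End Lift.

Definition pure_upd (a : {ffun I -> A}) i x : tensor A I := pure (upd a i x).

Fact pure_upd_is_nmod_morphism a i : nmod_morphism (pure_upd a i).
Proof.
have D x y : pure_upd a i (x + y) = pure_upd a i x + pure_upd a i y.
  rewrite -raddfD; apply/tensor_pi_eq; rewrite opprD addrA; exact: tensor_rel_add.
split=> [|x y]; last exact: D.
by apply: (addrI (pure_upd a i 0)); rewrite -D !addr0.
Qed.

HB.instance Definition _ a i :=
  GRing.isNmodMorphism.Build A (tensor A I) (pure_upd a i)
    (pure_upd_is_nmod_morphism a i).

Variables (K : Type) (b : K -> A) (c : K -> A -> int).
Hypothesis cD : forall k x y, c k (x + y) = c k x + c k y.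

(** With [c k] the coordinate function of [b k], this is the coordinate along the tensor of the
    [b (f i)]. *)
Definition coord (f : {ffun I -> K}) : tensor A I -> int :=
  tensor_lift (fun a => \prod_i c (f i) (a i)).

Lemma prod_coordD (f : {ffun I -> K}) a i x y :
  \prod_j c (f j) (upd a i (x + y) j) =
  \prod_j c (f j) (upd a i x j) + \prod_j c (f j) (upd a i y j).
Proof.
have E z : \prod_j c (f j) (upd a i z j) =
    c (f i) z * \prod_(j | j != i) c (f j) (a j).
  rewrite (bigD1 i) //= ffunE eqxx; congr (_ * _).
  by apply: eq_bigr => j /negbTE ji; rewrite ffunE ji.
by rewrite !E cD mulrDl.
Qed.

Lemma coordB f : zmod_morphism (coord f).
Proof. exact/tensor_lift_is_zmod_morphism/prod_coordD. Qed.

Lemma coord_pure f a : coord f (pure a) = \prod_i c (f i) (a i).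
Proof. exact/(tensor_lift_pure (prod_coordD f)). Qed.

Fixpoint index_funs (f0 : {ffun I -> K}) (ks : seq K) (s : seq I) : seq {ffun I -> K} :=
  if s is i :: s' then
    [seq [ffun j => if j == i then k else (f : {ffun I -> K}) j]
       | k <- ks, f <- index_funs f0 ks s']
  else [:: f0].

(** Multilinear expansion, one tensor factor at a time; [s] lists the factors already expanded. *)
Lemma pure_expand f0 ks (a : {ffun I -> A}) s : uniq s ->
  (forall i, a i = \sum_(k <- ks) b k *~ c k (a i)) ->
  pure a = \sum_(f <- index_funs f0 ks s)
    pure [ffun i => if i \in s then b (f i) else a i]
      *~ \prod_(i <- s) c (f i) (a i).
Proof.
move=> us aE; elim: s us => [_|i s IHs] /=.
  rewrite big_seq1 big_nil mulr1z; congr pure; by apply/ffunP=> j; rewrite ffunE.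
case/andP=> nis us; rewrite (IHs us) big_allpairs_dep exchange_big /=.
apply: eq_bigr => f _; set h := [ffun j => _].
have -> : pure h = pure_upd h i (\sum_(k <- ks) b k *~ c k (a i)).
  congr pure; apply/ffunP=> j; rewrite !ffunE.
  by case: eqP => // ->; rewrite (negbTE nis) -aE.
rewrite raddf_sum mulrz_suml; apply: eq_bigr => k _.
rewrite raddfMz -mulrzA big_cons ffunE eqxx; congr (pure _ *~ (_ * _)).
  apply/ffunP=> j; rewrite !ffunE inE; case: eqP => //= _.
rewrite big_seq [RHS]big_seq; apply: eq_bigr => j js; rewrite ffunE.
by case: eqP nis => // <-; rewrite js.
Qed.

Hypothesis coverage : exists ks : nat -> seq K,
  forall a, exists N, forall M, (N <= M)%N -> a = \sum_(k <- ks M) b k *~ c k a.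

(** The algebra may have infinite rank, so each tensor is expanded over a finite list of indices.
    Since the expansion holds for all large [M], two tensors can share a list, which gives the
    additive step. *)
Lemma tensor_expand (k0 : K) (t : tensor A I) : exists ks : seq K,
  t = \sum_(f <- index_funs [ffun=> k0] ks (index_enum I))
        pure [ffun i => b (f i)] *~ coord f t.
Proof.
have [ks ksP] := coverage.
suff [N H] : exists N, forall M, (N <= M)%N ->
    t = \sum_(f <- index_funs [ffun=> k0] (ks M) (index_enum I))
          pure [ffun i => b (f i)] *~ coord f t.
  by exists (ks N); apply: H.
move: t; apply: tensor_ind => [|u v [N uE] [N' vE]|a].
- exists 0%N => M _; rewrite big1 // => f _.
  by rewrite -[X in coord f X](subrr 0) coordB subrr mulr0z.
- exists (maxn N N') => M; rewrite geq_max => /andP[NM N'M].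
  rewrite {1}(uE _ NM) {1}(vE _ N'M) -sumrB; apply: eq_bigr => f _.
  by rewrite coordB mulrzBr.
- have [N NP] := choice (fun i => ksP (a i)).
  exists (\max_i N i) => M NM.
  rewrite {1}(@pure_expand [ffun=> k0] (ks M) a (index_enum I)).
  + apply: eq_bigr => f _; rewrite coord_pure; congr (pure _ *~ _).
    by apply/ffunP=> i; rewrite !ffunE mem_index_enum.
  + exact: index_enum_uniq.
  + by move=> i; apply: NP; apply: leq_trans NM; apply: leq_bigmax.
Qed.

Lemma tensor_torsion_free (k0 : K) (t : tensor A I) n :
  (0 < n)%N -> t *+ n = 0 -> t = 0.
Proof.
move=> n_gt0 tn; have [ks ->] := tensor_expand k0 t.
rewrite big1 // => f _.
suff -> : coord f t = 0 by rewrite mulr0z.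
pose h : {additive tensor A I -> int} := HB.pack (coord f)
  (GRing.isZmodMorphism.Build _ _ (coord f) (coordB f)).
have : h (t *+ n) = 0 by rewrite tn raddf0.
by rewrite raddfMn /= => /eqP; rewrite mulrn_eq0 -leqn0 leqNgt n_gt0 => /eqP.
Qed.

End TensorTorsionFree.

Section GradedCoordinates.
Variables (A : comPzRingType) (A_ : nat -> set A).
Hypothesis hA : graded_free_algebra A_.

Lemma gradeD i a a' : A_ i a -> A_ i a' -> A_ i (a + a').
Proof.
move=> aA a'A; rewrite -[a']opprK; apply: (gradeB hA) => //.
by rewrite -sub0r; apply: (gradeB hA) => //; apply: (grade0 hA).
Qed.

Lemma homogeneous_components : exists pi : nat -> A -> A,
  [/\ forall i a, A_ i (pi i a), forall i a a', pi i (a + a') = pi i a + pi i a' &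
      forall a, exists N, forall M, (N <= M)%N -> a = \sum_(i < M) pi i a].
Proof.
(* Requiring [c] to vanish from [N] on makes the decomposition independent of its length, hence
   unique. Uniqueness then gives additivity of the chosen components. *)
pose dec a (c : nat -> A) := (forall i, A_ i (c i)) /\
  exists N, (forall i, (N <= i)%N -> c i = 0) /\ a = \sum_(i < N) c i.
have decP a : exists c, dec a c.
  have [N [c [cA ->]]] := grade_sum hA a.
  exists (fun i => if (i < N)%N then c i else 0); split=> [i|].
    by case: ifP => // _; apply: (grade0 hA).
  exists N; split=> [i|]; first by rewrite ltnNge => ->.
  by apply: eq_bigr => i _; rewrite ltn_ord.
have dec_ge a c : dec a c -> exists N, forall M, (N <= M)%N ->
    (forall i, (M <= i)%N -> c i = 0) /\ a = \sum_(i < M) c i.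
  case=> cA [N [c0 ->]]; exists N => M NM; split=> [i Mi|].
    by apply: c0; apply: leq_trans Mi.
  rewrite (big_ord_widen _ _ NM) big_mkcond; apply: eq_bigr => i _.
  by case: ltnP => // /c0.
have dec_uniq a c c' : dec a c -> dec a c' -> c =1 c'.
  move=> dc dc' i; have [N NP] := dec_ge _ _ dc; have [N' N'P] := dec_ge _ _ dc'.
  have [c0 aE] := NP _ (leq_maxl N N'); have [c'0 aE'] := N'P _ (leq_maxr N N').
  have [le|lt] := leqP (maxn N N') i; first by rewrite c0 // c'0.
  apply/eqP; rewrite -subr_eq0; apply/eqP.
  apply: (grade_direct hA (n := maxn N N') (c := fun i => c i - c' i)) => // [j|].
    by apply: (gradeB hA); [apply: dc.1 | apply: dc'.1].
  by rewrite sumrB -aE -aE' subrr.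
have [pi piP] := choice decP.
exists (fun i a => pi a i); split=> [i a|i a a'|a].
- exact: (piP a).1.
- apply: (dec_uniq _ _ (fun i => pi a i + pi a' i) (piP _)); split=> [j|].
    by apply: gradeD; [apply: (piP a).1 | apply: (piP a').1].
  have [N NP] := dec_ge _ _ (piP a); have [N' N'P] := dec_ge _ _ (piP a').
  have [c0 aE] := NP _ (leq_maxl N N'); have [c'0 aE'] := N'P _ (leq_maxr N N').
  exists (maxn N N'); split=> [j Nj|]; first by rewrite c0 // c'0 // addr0.
  by rewrite big_split /= -aE -aE'.
- by have [N NP] := dec_ge _ _ (piP a); exists N => M /NP[].
Qed.

(** Uniqueness of coordinates makes them additive on [A_ i]. Padding by zero to indices in [nat]
    gives all degrees the same type, so that choices over [i] can be made. *)
Lemma grade_coordinates i : exists (r : nat) (b : nat -> A) (m : nat -> A -> int),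
  (forall a, A_ i a -> a = \sum_(k < r) b k *~ m k a) /\
  (forall k a a', A_ i a -> A_ i a' -> m k (a + a') = m k a + m k a').
Proof.
have [r [b [bA bP]]] := grade_free hA i.
have [m mP] : exists m : A -> {ffun 'I_r -> int},
    forall a, A_ i a -> a = \sum_k b k *~ m a k.
  pose P a (m : {ffun 'I_r -> int}) := A_ i a -> a = \sum_k b k *~ m k.
  suff /choice[m mP] : forall a, exists m, P a m by exists m.
  move=> a; have [aA|naA] := pselect (A_ i a); last by exists [ffun=> 0].
  by have [m [mE _]] := bP a aA; exists m.
have mU a m' : A_ i a -> a = \sum_k b k *~ (m' : {ffun 'I_r -> int}) k -> m' = m a.
  move=> aA aE; have [m0 [_ U]] := bP a aA.
  by rewrite -(U _ aE) -(U _ (mP a aA)).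
have mD a a' k : A_ i a -> A_ i a' -> m (a + a') k = m a k + m a' k.
  move=> aA a'A; rewrite -(mU (a + a') [ffun k => m a k + m a' k]) ?ffunE //.
    exact: gradeD.
  rewrite {1}(mP a aA) {1}(mP a' a'A) -big_split /=.
  by apply: eq_bigr => j _; rewrite ffunE mulrzDr.
exists r, (fun k => oapp b 0 (insub k)), (fun k a => oapp (m a) 0 (insub k)).
split=> [a aA|k a a' aA a'A]; last by case: insubP => //= j _ _; apply: mD.
by rewrite {1}(mP a aA); apply: eq_bigr => k _; rewrite valK.
Qed.

Lemma graded_coordinates : exists (b : nat * nat -> A) (c : nat * nat -> A -> int),
  (forall k a a', c k (a + a') = c k a + c k a') /\
  exists ks : nat -> seq (nat * nat),
    forall a, exists N, forall M, (N <= M)%N -> a = \sum_(k <- ks M) b k *~ c k a.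
Proof.
have [pi [piA piD piE]] := homogeneous_components.
have [r rP] := choice grade_coordinates.
have [b bP] := choice rP; have [m mP] := choice bP.
exists (fun k => b k.1 k.2), (fun k a => m k.1 k.2 (pi k.1 a)); split=> [k a a'|].
  by rewrite piD; apply: (mP k.1).2.
exists (fun M => [seq (i, k) | i <- index_iota 0 M, k <- index_iota 0 (r i)]) => a.
have [N NP] := piE a; exists N => M NM.
rewrite big_allpairs_dep {1}(NP M NM) big_mkord.
apply: eq_bigr => i _ /=; rewrite {1}((mP i).1 _ (piA i a)).
by rewrite big_mkord.
Qed.

Lemma tensor_mulrn_eq0 (I : finType) (t : tensor A I) n :
  (0 < n)%N -> t *+ n = 0 -> t = 0.
Proof.
have [b [c [cD cov]]] := graded_coordinates.
exact: (tensor_torsion_free cD cov (0, 0)%N).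
Qed.

End GradedCoordinates.

(** * Cohomology classes *)

Section CohomologyClasses.
Variables (A : comPzRingType) (G : graph).

Definition cohomology_class (i : int) (u : cocycle A G i) : cohomology A G i :=
  \pi_(Quotient.quot (@coboundaries A G i))%qT u.

Lemma cohomology_classK i (x : cohomology A G i) : exists u, x = cohomology_class u.
Proof.
exists (generic_quotient.repr (x : Quotient.quot (@coboundaries A G i))).
by rewrite /cohomology_class generic_quotient.reprK.
Qed.

Lemma cohomology_class_is_zmod_morphism i : zmod_morphism (@cohomology_class i).
Proof. exact: (raddfB (\pi_(Quotient.quot (@coboundaries A G i)))%qT). Qed.

HB.instance Definition _ i := GRing.isZmodMorphism.Build _ _
  (@cohomology_class i) (@cohomology_class_is_zmod_morphism i).

Lemma cohomology_class_eq0 i (u : cocycle A G i) : cohomology_class u = 0 <->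
  exists2 w, in_degree (i - 1) w & differential w = u.
Proof.
rewrite -(raddf0 (@cohomology_class i)); split=> [/eqP|wu].
  by rewrite /cohomology_class -Quotient.idealrBE subr0 => /asboolP.
by apply/eqP; rewrite /cohomology_class -Quotient.idealrBE subr0; apply/asboolP.
Qed.

Lemma in_degree_lt0 i (u : cochain A G) : i < 0 -> in_degree i u -> u = 0.
Proof.
move=> i_lt0 /in_degreeP du; apply/ffunP=> s; rewrite dsum0E; apply: du.
by apply: contraTneq i_lt0 => <-; rewrite -leNgt.
Qed.

Lemma cohomology_lt0 i (x : cohomology A G i) : i < 0 -> x = 0.
Proof.
move=> i_lt0; have [u ->] := cohomology_classK x.
apply/cohomology_class_eq0; exists 0; first exact: in_degree0.
have /andP[du _] : cocycle_val u \in cocycles i := cocycleP u.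
by rewrite raddf0 (in_degree_lt0 i_lt0 du).
Qed.

Lemma cohomology_exact i (x : cohomology A G i) :
  exact_at A finset.set0 [set: edge G] i -> x = 0.
Proof.
move=> ex; have [u ->] := cohomology_classK x.
have /andP[du /eqP u0] : cocycle_val u \in cocycles i := cocycleP u.
have [s|t _|w [dw _ wu]] := ex u du.
- by rewrite finset.sub0set.
- by rewrite u0 dsum0E.
apply/cohomology_class_eq0; exists w => //.
by apply/ffunP=> t; apply: wu; apply: finset.subsetT.
Qed.

(** There are no cochains in degree -1, so a torsion class is a torsion cocycle, whose values lie in
    torsion-free tensor powers. *)
Lemma cohomology0_torsion_free (A_ : nat -> set A) (x : cohomology A G 0) n :
  graded_free_algebra A_ -> (0 < n)%N -> x *+ n = 0 -> x = 0.
Proof.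
move=> hA n_gt0; have [u ->] := cohomology_classK x.
rewrite -raddfMn => /cohomology_class_eq0[w /(in_degree_lt0 _) -> // un].
suff -> : u = 0 by rewrite raddf0.
apply/val_inj/ffunP => s; rewrite dsum0E.
apply: (tensor_mulrn_eq0 hA n_gt0).
have mulE (v : cochain A G) m : (v *+ m) s = v s *+ m.
  by elim: m => [|m IHm]; rewrite ?mulr0n ?dsum0E // !mulrS -IHm ffunE.
rewrite -mulE -raddfMn. by rewrite /= -un raddf0 dsum0E.
Qed.

End CohomologyClasses.

Theorem theorem4 (A : comPzRingType) (A_ : nat -> set A)
  (hA : graded_free_algebra A_) (G : graph) (i : int) :
  let v1 := #|nontree_part G| in
  let mu1 := num_components (nontree_part G) in
  ([set: cohomology A G i]%classic <> [set 0]%classic ->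
     (0 <= i) /\ (i <= v1%:Z - 2 * mu1%:Z)) /\
  (torsion (cohomology A G i) <> [set 0]%classic ->
     (1 <= i) /\ (i <= v1%:Z - 2 * mu1%:Z)).
Proof.
move=> v1 mu1.
have bound (x : cohomology A G i) : x <> 0 -> (0 <= i) /\ (i <= v1%:Z - 2 * mu1%:Z).
  move=> x0; split; rewrite leNgt; apply/negP => i_out; apply: x0.
    exact: cohomology_lt0.
  exact/cohomology_exact/exact_above_nontree.
split=> [nz|nz].
  apply: contrapT => out; apply: nz; apply/seteqP; split=> x //= _.
  by apply: contrapT => /bound.
have [x [n [n_gt0 xn]] x0] : exists2 x, torsion (cohomology A G i) x & x <> 0.
  apply: contrapT => notors; apply: nz; apply/seteqP; split=> x /=.
    by move=> tx; apply: contrapT => x0; apply: notors; exists x.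
  by move=> ->; exists 1%N.
have [i_ge0 i_le] := bound x x0; split=> //.
rewrite -gtz0_ge1 lt_neqAle i_ge0 andbT; apply/eqP => i0.
by subst i; apply: x0; apply: (cohomology0_torsion_free hA n_gt0).
Qed.
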